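(* Let $\epsilon\in(0,\infty)$, $\beta\in(\frac14,1)$, $\alpha\in[0,\sqrt\beta)$, $p\in[2,\infty)$, $d\in\mathbb N$, $\vartheta\in\mathbb R^d$, and let $(\gamma_n)_{n\in\mathbb N}\subseteq(0,\infty)$ be a non-summable decreasing sequence converging to zero which satisfies $\sup_{\varepsilon\in(0,\infty)}\liminf_{n\to\infty}\bigl((\gamma_n)^{-1}\gamma_{n+\lceil(\gamma_n)^{-1}\varepsilon\rceil}\bigr)>0$ and $\sum_{n=1}^\infty(\gamma_n)^{1+p/3}<\infty$. Let $R:\mathbb R^d\to\mathbb R$ be the empirical loss function for training data $(y_1,z_1),\dots,(y_N,z_N)\in\mathcal Y\times\mathbb R$ (with realization function $\mathfrak N$) with pairwise different inputs $y_1,\dots,y_N\in\mathcal Y$. Let $M\in\mathbb N$ and let $(X_M,\mathbf U)$ be the mini-batch gradient estimator of size $M$ for this training data; assume that it is a locally $p$-regular innovation and that $$M>\frac{\log(2\sqrt\beta-1)}{\log(1-\frac1N)}$$ (for $N=1$ the right-hand side is read as $0$). Let $(\theta_n)_{n\in\mathbb N_0}$ be the Adam algorithm with innovation $(X_M,\mathbf U)$, step-sizes $(\gamma_n)_{n\in\mathbb N}$ and damping parameters $(\alpha,\beta,\epsilon)$ started in $\vartheta$. Let $\mathcal C\subset R^{-1}(\{0\})$ be a closed and non-empty set and let $K\subset\mathbb R^d$ be compact. Assume that there exists a neighborhood $\mathcal D\supset\mathcal C\cap K$ such that $\mathcal C\cap\mathcal D=\arg\min R|_{\mathcal D}$ and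 such that $R$ satisfies the Polyak–Łojasiewicz inequality on $\mathcal D$, i.e. there exists $\mu>0$ such that for all $\theta\in\mathcal D$ $$2\mu R(\theta)\le|\nabla R(\theta)|^2 .$$ Then there exists a neighborhood $V\supset\mathcal C\cap K$ such that for almost all $$\omega\in\bigl\{\theta_n\in V\text{ for infinitely many }n\in\mathbb N_0\bigr\}\cap\bigcup_{n_0\in\mathbb N_0}\bigcap_{n\ge n_0}\{\theta_n\in K\}$$ one has $\lim_{n\to\infty}\operatorname{dist}(\theta_n(\omega),\mathcal C)=0$.
   Context: Empirical risk: let $\mathcal Y$ be a set, $N\in\mathbb N$, $(y_1,z_1),\dots,(y_N,z_N)\in\mathcal Y\times\mathbb R$ (training data), and $\mathfrak N:\mathbb R^d\times\mathcal Y\to\mathbb R$, $(\theta,y)\mapsto\mathfrak N^\theta(y)$, a function that is $C^1$ in $\theta$ for each fixed $y$ (realization function). The empirical loss function is $R(\theta)=\frac1{2N}\sum_{i=1}^N|\mathfrak N^\theta(y_i)-z_i|^2$. The mini-batch gradient estimator of size $M\in\mathbb N$ is the innovation $(X_M,\mathbf U)$ with $\mathbf U$ a vector of $M$ independent random variables uniformly distributed on $\{1,\dots,N\}$ and $$X_M(\mathbf u,\theta)=-\frac1M\sum_{i=1}^M\nabla_\theta\mathfrak N^\theta(y_{\mathbf u_i})\,(\mathfrak N^\theta(y_{\mathbf u_i})-z_{\mathbf u_i}).$$ $\operatorname{dist}(\theta,\mathcal C)$ is the Euclidean distance from $\theta$ to $\mathcal C$. Innovation: a pair $(X,U)$ where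 $U$ is a random variable on a probability space $(\Omega,\mathcal F,\mathbb P)$ with values in a measurable space $\mathcal U$ and $X:\mathcal U\times\mathbb R^d\to\mathbb R^d$ is product measurable. $X^{(j)}$ is the $j$-th component. For $p\in[2,\infty)$, $(X,U)$ is locally $p$-regular if there is a continuous $c:\mathbb R\to\mathbb R$ such that for all $\theta,\vartheta\in\mathbb R^d$: $\mathbb E[|X(U,\theta)|^p]\le c(0)(1+e^{c(0)|\theta|})$ and $\mathbb E[|X(U,\theta)-X(U,\vartheta)|^p]\le c(|\theta|+|\vartheta|)\,|\theta-\vartheta|^p$. Adam algorithm with innovation $(X,U)$, step-sizes $(\gamma_n)_{n\in\mathbb N}$, damping parameters $(\alpha,\beta,\epsilon)$, started in $\vartheta$: a process $(\theta_n)_{n\in\mathbb N_0}$ in $\mathbb R^d$ for which there are i.i.d. copies $U_1,U_2,\dots$ of $U$ such that $\theta_0=\vartheta$, $m_0=v_0=0\in\mathbb R^d$, and for all $n\in\mathbb N$, $j\in\{1,\dots,d\}$: $$m_n=\alpha m_{n-1}+(1-\alpha)X(U_n,\theta_{n-1}),\quad v_n^{(j)}=\beta v_{n-1}^{(j)}+(1-\beta)(X^{(j)}(U_n,\theta_{n-1}))^2,$$ $$\sigma_n^{(j)}=\bigl(\sqrt{v_n^{(j)}/(1-\beta^n)}+\epsilon\bigr)^{-1},\quad \theta_n^{(j)}=\theta_{n-1}^{(j)}+\gamma_n\sigma_n^{(j)}m_n^{(j)}.$$ *)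

(* Defs.v *)
From HB Require Import structures.
From mathcomp Require Import all_boot all_order all_algebra finmap.
From mathcomp Require Import all_classical all_reals all_analysis.

Set Implicit Arguments.
Unset Strict Implicit.
Unset Printing Implicit Defensive.

Import Order.TTheory GRing.Theory Num.Theory.
Import numFieldNormedType.Exports.

Local Open Scope classical_set_scope.
Local Open Scope ring_scope.

(* Vectors of R^d are row vectors 'rV[R]_d.  The norm that the library puts on
   'rV[R]_d is the maximum norm; it is used here only through the topology and
   the differentiability it induces, which are the Euclidean ones.
   Every |.| of the mathematics is the Euclidean norm enorm. *)
Definition enorm (R : realType) (d : nat) (x : 'rV[R]_d) : R :=
  Num.sqrt (\sum_(j < d) x 0 j ^+ 2).

Definition dist_to (R : realType) (d : nat) (x : 'rV[R]_d)
    (C : set 'rV[R]_d) : R :=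
  inf [set enorm (x - c) | c in C].

Definition grad (R : realType) (d : nat) (f : 'rV[R]_d -> R)
    (x : 'rV[R]_d) : 'rV[R]_d :=
  \row_(j < d) 'D_(delta_mx 0 j) f x.

Definition C1 (R : realType) (d : nat) (f : 'rV[R]_d -> R) : Prop :=
  (forall x, differentiable f x) /\ continuous (grad f).

Definition argmin_on (R : realType) (T : Type) (f : T -> R) (D : set T) :
    set T :=
  [set x | D x /\ forall x', D x' -> f x <= f x'].

Definition PL_on (R : realType) (d : nat) (f : 'rV[R]_d -> R)
    (D : set 'rV[R]_d) : Prop :=
  exists2 mu : R, 0 < mu &
    forall x, D x -> 2 * mu * f x <= enorm (grad f x) ^+ 2.

Definition borel_rV (R : realType) (d : nat) :=
  g_sigma_algebraType (@open 'rV[R]_d).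

(* Finite nonempty index sets carry the discrete sigma-algebra.  Measurable
   types are pointed in the library, hence the successor. *)
HB.instance Definition _ (n : nat) := isPointed.Build 'I_n.+1 ord0.
HB.instance Definition _ (n : nat) := @isMeasurable.Build default_measure_display
  'I_n.+1 (@discrete_measurable 'I_n.+1) (@discrete_measurable0 _)
  (@discrete_measurableC _) (@discrete_measurableU _).

Definition mutually_independent (dO dT : measure_display) (R : realType)
    (Omega : measurableType dO) (T : measurableType dT)
    (P : probability Omega R) (I : choiceType) (X : I -> Omega -> T) : Prop :=
  forall (J : {fset I}) (A : I -> set T), (forall i, measurable (A i)) ->
    (P (\bigcap_(i in [set` J]) (X i @^-1` A i)) =
     \prod_(i <- J) P (X i @^-1` A i))%E.

(* The family Us enumerates from 0: Us k is the (k+1)-st copy. *)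
Definition iid_copies (dO' dO dT : measure_display) (R : realType)
    (Omega' : measurableType dO') (Omega : measurableType dO)
    (T : measurableType dT) (P' : probability Omega' R)
    (P : probability Omega R) (U : {RV P' >-> T})
    (Us : nat -> {RV P >-> T}) : Prop :=
  mutually_independent P (fun k => Us k : Omega -> T) /\
  forall k (A : set T), measurable A ->
    distribution P (Us k) A = distribution P' U A.

Definition innovation_fun (dT : measure_display) (R : realType) (d : nat)
    (T : measurableType dT) (X : T -> 'rV[R]_d -> 'rV[R]_d) : Prop :=
  measurable_fun setT
    (fun x : T * borel_rV R d => X x.1 x.2 : borel_rV R d).

Definition locally_regular (dO dT : measure_display) (R : realType) (d : nat)
    (Omega : measurableType dO) (T : measurableType dT)
    (P : probability Omega R) (p : R)
    (X : T -> 'rV[R]_d -> 'rV[R]_d) (U : {RV P >-> T}) : Prop :=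
  exists2 c : R -> R, continuous c &
    forall theta vartheta : 'rV[R]_d,
      ('E_P[fun w => (enorm (X (U w) theta) `^ p)%R]
         <= (c 0 * (1 + expR (c 0 * enorm theta)))%:E)%E /\
      ('E_P[fun w => (enorm (X (U w) theta - X (U w) vartheta) `^ p)%R]
         <= (c (enorm theta + enorm vartheta)
             * enorm (theta - vartheta) `^ p)%:E)%E.

Definition adam_sigma (R : realType) (d : nat) (beta eps : R) (n : nat)
    (v : 'rV[R]_d) (j : 'I_d) : R :=
  (Num.sqrt (v 0 j / (1 - beta ^+ n)) + eps)^-1.

(* The step leading from theta n to theta n.+1 uses gamma n and the n-th member
   (from 0) of the i.i.d. family; these are written gamma_{n+1} and U_{n+1} when
   step-sizes and innovations are numbered from 1. *)
Definition adam_algorithm (dO' dO dT : measure_display) (R : realType)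
    (d : nat) (Omega' : measurableType dO') (Omega : measurableType dO)
    (T : measurableType dT) (P' : probability Omega' R)
    (P : probability Omega R)
    (X : T -> 'rV[R]_d -> 'rV[R]_d) (U : {RV P' >-> T}) (gamma : nat -> R)
    (alpha beta eps : R) (vartheta : 'rV[R]_d)
    (theta : nat -> Omega -> 'rV[R]_d) : Prop :=
  exists (Us : nat -> {RV P >-> T}) (m v : nat -> Omega -> 'rV[R]_d),
    [/\ iid_copies U Us,
        forall w, [/\ theta 0%N w = vartheta, m 0%N w = 0 & v 0%N w = 0] &
        forall n w,
          let x := X (Us n w) (theta n w) in
          m n.+1 w = alpha *: m n w + (1 - alpha) *: x /\
          forall j : 'I_d,
            v n.+1 w 0 j = beta * v n w 0 j + (1 - beta) * x 0 j ^+ 2 /\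
            theta n.+1 w 0 j = theta n w 0 j
              + gamma n * adam_sigma beta eps n.+1 (v n.+1 w) j
                * m n.+1 w 0 j].

Definition empirical_loss (R : realType) (d : nat) (Y : Type) (N : nat)
    (NN : 'rV[R]_d -> Y -> R) (y : 'I_N -> Y) (z : 'I_N -> R)
    (theta : 'rV[R]_d) : R :=
  (2 * N%:R)^-1 * \sum_(i < N) `|NN theta (y i) - z i| ^+ 2.

Definition minibatch_gradient (R : realType) (d : nat) (Y : Type) (N M : nat)
    (NN : 'rV[R]_d -> Y -> R) (y : 'I_N -> Y) (z : 'I_N -> R)
    (u : M.-tuple 'I_N) (theta : 'rV[R]_d) : 'rV[R]_d :=
  - (M%:R^-1 *: \sum_(i < M)
      (NN theta (y (tnth u i)) - z (tnth u i))
        *: grad (NN^~ (y (tnth u i))) theta).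

Definition independent_uniform (dO : measure_display) (R : realType)
    (Omega : measurableType dO) (P : probability Omega R) (n M : nat)
    (U : {RV P >-> (M.-tuple 'I_n.+1)%type}) : Prop :=
  mutually_independent P (fun (i : 'I_M) w => tnth (U w) i) /\
  forall (i : 'I_M) (k : 'I_n.+1),
    (P [set w | tnth (U w) i = k] = (n.+1%:R^-1)%:E)%E.

(* For N = 1 the denominator is log 0 = -oo, hence the value 0. *)
Definition batch_threshold (R : realType) (beta : R) (N : nat) : R :=
  if N == 1%N then 0
  else ln (2 * Num.sqrt beta - 1) / ln (1 - N%:R^-1).

(* Main.v *)
Require Import Defs.
From HB Require Import structures.
From mathcomp Require Import all_boot all_order all_algebra finmap.
From mathcomp Require Import all_classical all_reals all_analysis.
From mathcomp Require Import measurable_realfun ring lra.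

Set Implicit Arguments.
Unset Strict Implicit.
Unset Printing Implicit Defensive.

Import Order.TTheory GRing.Theory Num.Theory.
Import numFieldNormedType.Exports.

Local Open Scope classical_set_scope.
Local Open Scope ring_scope.

(** Let loss be the empirical risk, X u the mini-batch gradient estimator for
    the batch u, and A := C `&` K.  On the compact set K the estimator is
    controlled by the risk itself, |X u x|^2 <= B * loss x, because X u x is
    linear in the residuals [minibatch_sqn_le].  Hence near A both the noise and
    the second-moment vector v of Adam are small, the preconditioner
    (sqrt v + eps)^-1 is close to the constant eps^-1, and Adam behaves there
    like stochastic gradient descent with momentum, with step-size gamma / eps
    and with a multiplicative noise that disappears on the set of minima.

    With a_k = (alpha / eps) * \sum_i alpha^i * gamma_(k + i), which solves
    a_k = alpha * (gamma_k / eps + a_(k+1)), the Lyapunov function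
      Psi_k = loss theta + a_k * <grad loss theta, m> + b * gamma_k * |m|^2
    absorbs the momentum: the recursion for a_k makes the terms in
    <grad loss theta, m> cancel in conditional expectation, and the
    Polyak-Lojasiewicz inequality gives
      E[Psi_(k+1) | past] <= (1 - c * gamma_k) * Psi_k
    as long as theta is close to A and v and Psi_k are small
    [lyapunov_pointwise, lyapunov_drift, trap_level_drift].

    By compactness [zero_set_isolated], a trajectory that stays in K and moves by
    small steps cannot leave the neighbourhood of A without loss, and then Psi,
    exceeding a fixed level.  So trap_level, which is Psi divided by that level
    inside the neighbourhood and 1 outside, is a nonnegative supermartingale on
    the trajectories that stay in K.  Each time it is at most 1/2 it has
    conditional probability at least 1/2 of never returning to 1, so almost surely
    the excursions below 1/2 that end at 1 are finitely many; on the last one the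
    contraction factors 1 - c * gamma_k, whose product is 0, force convergence to
    0 [supermartingale_dichotomy].  Both facts follow from one application of the
    maximal inequality [supermartingale_maximal] to the fortune of a gambler who
    bets on the end of each excursion.

    A visit of theta to a small neighbourhood V of A makes trap_level at most 1/2
    a bounded number of steps later: theta hardly moves meanwhile, whereas v
    decays geometrically [trap_entered].  Hence visiting V infinitely often and
    staying in K eventually force loss to tend to 0 near A, which by compactness
    is convergence to C.

    The batches take finitely many values, so the iterates are functions of the
    finite sequence of batches drawn so far, and all conditional expectations are
    finite averages over the next batch. *)

(** * A maximal inequality on the tree of finite histories *)
Section random_path.
Context (d : measure_display) (Omega : measurableType d) (R : realType).
Variables (P : probability Omega R) (T : finType) (Us : nat -> Omega -> T).

(** The first n draws, the latest one first: nodes of the tree of histories are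
    sequences over T, and t :: h is the child of h in which t is drawn next. *)
Fixpoint history (n : nat) (w : Omega) : seq T :=
  if n is k.+1 then Us k w :: history k w else [::].

Lemma size_history n w : size (history n w) = n.
Proof. by elim: n => //= n ->. Qed.

(** The event that the first draws are those of h. *)
Definition cylinder (h : seq T) : set Omega :=
  [set w | history (size h) w = h].

Hypothesis cylinder_measurable : forall h, measurable (cylinder h).
Hypothesis cylinder_prob : forall h, P (cylinder h) = ((#|T|%:R ^- size h)%:E : \bar R).
Hypothesis T_gt0 : (0 < #|T|)%N.

Lemma measure_finunion_le (I : eqType) (s : seq I) (A : I -> set Omega)
    (c : I -> R) :
  (forall i, measurable (A i) /\ (P (A i) <= (c i)%:E)%E) ->
  measurable [set w | exists2 i, i \in s & A i w] /\
  (P [set w | exists2 i, i \in s & A i w] <= (\sum_(i <- s) c i)%:E)%E.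
Proof.
move=> Ac; elim: s => [|i s [mS PS]].
  have -> : [set w | exists2 i, i \in [::] & A i w] = set0.
    by apply/seteqP; split => // w [].
  by rewrite big_nil measure0.
have -> : [set w | exists2 j, j \in i :: s & A j w] =
    A i `|` [set w | exists2 j, j \in s & A j w].
  apply/seteqP; split => w /=.
    move=> [j]; rewrite inE => /orP[/eqP ->|js Aj]; first by left.
    by right; exists j.
  move=> [Ai|[j js Aj]]; first by exists i => //; rewrite mem_head.
  by exists j => //; rewrite inE js orbT.
have [mA PA] := Ac i; split; first exact: measurableU.
rewrite big_cons EFinD; apply: le_trans (leeD PA PS).
exact: measureU2.
Qed.

Section maximal.
Variables (f : seq T -> R) (lam : R).
Hypothesis lam0 : 0 < lam.
Hypothesis f0 : forall h, 0 <= f h.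
Hypothesis f_super : forall h, \sum_(t : T) f (t :: h) <= #|T|%:R * f h.

(** The event that the branch goes through h and that f reaches lam at h or at
    one of the k following nodes. *)
Let hit (h : seq T) (k : nat) : set Omega :=
  [set w | cylinder h w /\
    exists2 i, (i <= k)%N & lam <= f (history (size h + i) w)].

Let hit_le h k : measurable (hit h k) /\
  (P (hit h k) <= (f h / lam / #|T|%:R ^+ size h)%:E)%E.
Proof.
have T0 : 0 < #|T|%:R ^+ size h :> R by rewrite exprn_gt0// ltr0n.
have [lf|fl] := leP lam (f h).
  have -> : hit h k = cylinder h.
    apply/seteqP; split => w; first by case.
    move=> hw; split => //; exists 0%N => //.
    by rewrite addn0 hw.
  split; first exact: cylinder_measurable.
  rewrite cylinder_prob lee_fin ler_peMl ?invr_ge0 ?(ltW T0)//.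
  by rewrite ler_pdivlMr// mul1r.
(* Below lam at h, the level can only be reached in the subtree of a child. *)
elim: k h T0 fl => [|k IH] h T0 fl.
  have -> : hit h 0 = set0.
    apply/seteqP; split => // w [hw [i]]; rewrite leqn0 => /eqP ->.
    by rewrite addn0 hw leNgt fl.
  by rewrite measure0 lee_fin divr_ge0// ?(ltW T0)// divr_ge0// ltW.
have -> : hit h k.+1 = [set w | exists2 t, t \in enum T & hit (t :: h) k w].
  apply/seteqP; split => w.
    move=> [hw [[|i] ik Hi]]; first by move: Hi; rewrite addn0 hw leNgt fl.
    exists (Us (size h) w); first by rewrite mem_enum.
    split; first by rewrite /cylinder/= hw.
    by exists i => //; rewrite [size _]/= addSnnS.
  move=> [t _ [/= [_ htw] [i ik Hi]]]; split => //.
  by exists i.+1 => //; rewrite -addSnnS.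
have T0t (t : T) : 0 < #|T|%:R ^+ size (t :: h) :> R by rewrite exprn_gt0// ltr0n.
have [|mS PS] := @measure_finunion_le T (enum T) (fun t => hit (t :: h) k)
   (fun t => f (t :: h) / lam / #|T|%:R ^+ size (t :: h)).
  move=> t; have [lf|ftl] := leP lam (f (t :: h)); last exact: IH.
  have -> : hit (t :: h) k = cylinder (t :: h).
    apply/seteqP; split => w; first by case.
    move=> hw; split => //; exists 0%N => //.
    by rewrite addn0 hw.
  split; first exact: cylinder_measurable.
  rewrite cylinder_prob lee_fin ler_peMl ?invr_ge0 ?(ltW (T0t t))//.
  by rewrite ler_pdivlMr// mul1r.
split => //; apply: (le_trans PS); rewrite lee_fin big_enum/=.
rewrite -!mulr_suml exprS.
set S := \sum_(t : T) _; set X := _ ^+ size h.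
have -> : S / lam / (#|T|%:R * X) = S / #|T|%:R / lam / X by rewrite invfM; ring.
rewrite !ler_pM2r ?invr_gt0// ler_pdivrMr ?ltr0n// mulrC; exact: f_super.
Qed.

(** A nonnegative function on the tree whose average over the children of any
    node is at most its value at that node exceeds lam along a random branch
    with probability at most (value at the root) / lam. *)
Lemma supermartingale_maximal :
  measurable [set w | exists n, lam <= f (history n w)] /\
  (P [set w | exists n, (lam <= f (history n w))%R] <= (f [::] / lam)%:E)%E.
Proof.
have E : [set w | exists n, lam <= f (history n w)] = \bigcup_k hit [::] k.
  apply/seteqP; split => w.
    by move=> [n Hn]; exists n => //; split => //; exists n.
  by move=> [k _ [_ [i _ Hi]]]; exists i.
have mh k : measurable (hit [::] k) by have [] := hit_le [::] k.
rewrite E; split; first exact: bigcup_measurable.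
have nd : {homo hit [::] : n m / (n <= m)%N >-> (n <= m)%O}.
  move=> n m nm; apply/subsetPset => w [? [i i_n Hi]]; split => //.
  by exists i => //; exact: leq_trans nm.
have cv := nondecreasing_cvg_mu (mu := P) mh (bigcupT_measurable _ mh) nd.
rewrite -(cvg_lim _ cv)//; apply: lime_le.
  by apply/cvg_ex; exists (P (\bigcup_k hit [::] k)).
apply: nearW => k /=; have [_] := hit_le [::] k.
by rewrite /= expr0 divr1.
Qed.

End maximal.
End random_path.

(** * Excursions of a supermartingale *)
Section excursions.
(** Along one branch, k is the stake of the gambler, b says whether the bet is
    running, and c is the contraction rate of y while it runs: the stake
    doubles when y drops to 1/2, grows like the inverse contraction factors while
    the bet runs, and is kept when y is back to 1 and the bet stops. *)
Context (R : realType).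
Variables (c k y : nat -> R) (b : nat -> bool) (n1 : nat) (L : R).
Hypothesis c01 : forall n, 0 <= c n < 1.
Hypothesis c_div : forall B : R, exists n, B <= \sum_(i < n) c i.
Hypothesis k1 : 1 <= k n1.
Hypothesis step : forall n, (n1 <= n)%N ->
  if b n then k n.+1 = k n / (1 - c n) /\ b n.+1 = (y n.+1 < 1)
  else if y n.+1 <= 2^-1 then k n.+1 = 2 * k n /\ b n.+1 = true
  else k n.+1 = k n /\ b n.+1 = false.
Hypothesis kL : forall n, (if b n then k n * y n else k n) < L.
Hypothesis y_ge0 : forall n, (n1 < n)%N -> 0 <= y n.
Hypothesis y_io : forall N, exists2 n, (N <= n)%N & y n <= 2^-1.

Let k_ge1 n : (n1 <= n)%N -> 1 <= k n /\ k n <= k n.+1.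
Proof.
have kmon m : (n1 <= m)%N -> 1 <= k m -> k m <= k m.+1.
  move=> nm k1m; move: (step nm); case: (b m).
    move=> [-> _]; have /andP[c0 c1] := c01 m.
    by rewrite ler_pdivlMr ?subr_gt0// ler_piMr ?(le_trans ler01)// lerBlDr lerDl.
  case: ifP => _ [-> _] //.
  by rewrite mulrDl mul1r lerDl (le_trans ler01).
have k_1 m : (n1 <= m)%N -> 1 <= k m.
  elim: m => [|m IH]; first by rewrite leqn0 => /eqP <-.
  rewrite leq_eqVlt => /orP[/eqP <- //|]; rewrite ltnS => nm.
  exact: le_trans (IH nm) (kmon _ nm (IH nm)).
by move=> nm; split; [exact: k_1 | exact/kmon/k_1].
Qed.

Let k_homo n m : (n1 <= n <= m)%N -> k n <= k m.
Proof.
move=> /andP[nn]; elim: m => [|m IH]; first by rewrite leqn0 => /eqP ->.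
rewrite leq_eqVlt => /orP[/eqP <- //|]; rewrite ltnS => nm.
by apply: le_trans (IH nm) _; case: (k_ge1 (leq_trans nn nm)).
Qed.

(** One excursion, from a waiting time n to an active time m, doubles k. *)
Let k_double n m : (n1 <= n <= m)%N -> ~~ b n -> b m -> 2 * k n <= k m.
Proof.
move=> /andP[nn]; elim: m => [|m IH].
  by rewrite leqn0 => /eqP -> /negbTE ->.
rewrite leq_eqVlt => /orP[/eqP <- /negbTE -> //|]; rewrite ltnS => nm bn bm1.
have nm1 := leq_trans nn nm.
case bm : (b m); first exact: le_trans (IH nm bn bm) (k_ge1 nm1).2.
move: (step nm1); rewrite bm; case: ifP => _ [-> bm1']; last by rewrite bm1' in bm1.
by rewrite ler_pM2l// k_homo// nn.
Qed.

Let active_of_small m : (n1 < m)%N -> y m <= 2^-1 -> b m.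
Proof.
case: m => // m; rewrite ltnS => nm ym; move: (step nm); case: (b m).
  by move=> [_ ->]; apply: le_lt_trans ym _; lra.
by rewrite ym => -[].
Qed.

Let active_eventually : exists2 n0, (n1 <= n0)%N & forall n, (n0 <= n)%N -> b n.
Proof.
apply: contrapT => H.
have wait N : exists n, (N <= n)%N && ~~ b n.
  apply: contrapT => HN; apply: H; exists (maxn n1 N); first exact: leq_maxl.
  move=> n; rewrite geq_max => /andP[_ Nn]; apply: contrapT => /negP bn.
  by apply: HN; exists n; rewrite Nn.
have big j : exists2 n, (n1 <= n)%N & ~~ b n /\ 2 ^+ j <= k n.
  elim: j => [|j [n nn [bn kn]]].
    have [n /andP[nn bn]] := wait n1; exists n => //; split => //.
    by have [] := k_ge1 nn.
  have [m nm ym] := y_io n.+1; have nm1 : (n1 < m)%N by exact: leq_ltn_trans nm.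
  have bm := active_of_small nm1 ym.
  have [l /andP[ml bl]] := wait m; exists l; first exact: leq_trans (ltnW nm1) ml.
  split => //; rewrite exprS.
  have h1 : 2 * k n <= k m by apply: k_double; rewrite // nn ltnW.
  have h2 : k m <= k l by apply: k_homo; rewrite (ltnW nm1).
  by apply: le_trans h2; apply: le_trans h1; rewrite ler_pM2l.
have L2 : L < 2 ^+ (Num.truncn `|L|).+1.
  apply: (le_lt_trans (ler_norm _)); apply: lt_trans (truncnS_gt _) _.
  by rewrite -natrX ltr_nat ltn_expl.
have [n nn [/negbTE bn kn]] := big (Num.truncn `|L|).+1.
by have := kL n; rewrite bn ltNge (le_trans (ltW L2) kn).
Qed.

(** If the fortune stays below L, the doublings are finitely many; hence a bet
    runs forever and y is at most L divided by a stake that tends to infinity. *)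
Lemma excursions_cvg0 : y @ \oo --> 0.
Proof.
have [n0 nn0 act] := active_eventually.
have kS i : 1 + \sum_(j < i) c (n0 + j)%N <= k (n0 + i)%N.
  elim: i => [|i IH]; first by rewrite big_ord0 addr0 addn0; case: (k_ge1 nn0).
  rewrite big_ord_recr/= addnS.
  have := step (leq_trans nn0 (leq_addr i n0)); rewrite act ?leq_addr// => -[-> _].
  have /andP[c0 c1] := c01 (n0 + i).
  rewrite ler_pdivlMr ?subr_gt0//.
  set S := \sum_(j < i) _ in IH *.
  have S0 : 0 <= S by apply: sumr_ge0 => j _; case/andP: (c01 (n0 + j)).
  by nra.
apply/cvgrPdist_le => e e0.
have [N HN] := c_div (L / e + \sum_(i < n0) c i).
near=> n; rewrite sub0r normrN.
have nn : (n0 <= n)%N by near: n; exact: nbhs_infty_ge.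
have Nn : (N <= n)%N by near: n; exact: nbhs_infty_ge.
have n1n : (n1 < n)%N by apply: leq_ltn_trans nn0 _; near: n; exact: nbhs_infty_gt.
rewrite ger0_norm; last exact: y_ge0.
have := kL n; rewrite act// => kyL.
have := kS (n - n0)%N; rewrite subnKC// => kn.
have kLe : L / e <= k n.
  apply: le_trans kn; apply: ler_wpDl => //.
  rewrite -(lerD2r (\sum_(i < n0) c i)); apply: (le_trans HN).
  have -> : \sum_(j < n - n0) c (n0 + j)%N + \sum_(i < n0) c i = \sum_(i < n) c i.
    by rewrite -[in RHS](subnKC nn) big_split_ord/= addrC.
  rewrite -[in leRHS](subnKC Nn) big_split_ord/= lerDl.
  by apply: sumr_ge0 => j _; case/andP: (c01 (N + j)).
have y0 := y_ge0 n1n.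
have k0 : 0 < k n.
  by apply: lt_le_trans ltr01 _; case: (k_ge1 (ltnW n1n)).
rewrite -(ler_pM2l k0); apply: (le_trans (ltW kyL)).
by rewrite -ler_pdivrMr.
Unshelve. all: by end_near.
Qed.

End excursions.

Section dichotomy.
Context (d : measure_display) (Omega : measurableType d) (R : realType).
Variables (P : probability Omega R) (T : finType) (Us : nat -> Omega -> T).
Hypothesis cylinder_measurable : forall h, measurable (cylinder Us h).
Hypothesis cylinder_prob :
  forall h, P (cylinder Us h) = ((#|T|%:R ^- size h)%:E : \bar R).
Hypothesis T_gt0 : (0 < #|T|)%N.

Variables (y : seq T -> R) (A : seq T -> bool) (c : nat -> R) (n1 : nat).
Hypothesis c01 : forall n, 0 <= c n < 1.
Hypothesis c_div : forall B : R, exists n, B <= \sum_(i < n) c i.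
Hypothesis y_ge0 : forall h, (n1 < size h)%N -> A h -> 0 <= y h.
Hypothesis y_super : forall h, (n1 < size h)%N -> A h -> y h < 1 ->
  \sum_(t : T) (if A (t :: h) then y (t :: h) else 0) <=
  #|T|%:R * ((1 - c (size h)) * y h).

(** Stake of the gambler at the node h, and whether the bet is running.  The
    gambler waits with stake 1 until time n1, and the stake is set to 0, where it
    remains, as soon as a later node violates A. *)
Fixpoint weight (h : seq T) : R * bool :=
  if h is _ :: h' then
    if (size h' < n1)%N then (1, false) else
    let: (k, b) := weight h' in
    let k' := if A h then k else 0 in
    if b then (k' / (1 - c (size h')), y h < 1)
    else if y h <= 2^-1 then (2 * k', true) else (k', false)
  else (1, false).

(** Fortune at h.  A bet on the return of y to 1 is taken with the doubled stake
    when y <= 1/2, which does not increase the fortune; it is left when y >= 1,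
    keeping the stake, which is then at most the fortune. *)
Definition bet (h : seq T) : R :=
  if (weight h).2 then (weight h).1 * y h else (weight h).1.

Let weight_inv h : 0 <= (weight h).1 /\
  ((weight h).2 -> y h < 1 /\ (0 < (weight h).1 -> (n1 < size h)%N /\ A h)).
Proof.
elim: h => //= t h; case: (ltnP (size h) n1) => // nh.
case: (weight h) => k b /= [k0 _].
have k'0 : 0 <= if A (t :: h) then k else 0 by case: ifP.
have /andP[c0 c1] := c01 (size h).
case: b => /=.
  split; first by rewrite divr_ge0// subr_ge0 ltW.
  move=> y1; split => //; case: (A (t :: h)); first by rewrite ltnS nh.
  by rewrite mul0r ltxx.
case: (leP (y (t :: h)) 2^-1) => [y12|_] /=; last by split.
split; first by rewrite mulr_ge0.
move=> _; split; first by apply: le_lt_trans y12 _; lra.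
by case: (A (t :: h)); rewrite ?mulr0 ?ltxx.
Qed.

Let bet_ge0 h : 0 <= bet h.
Proof.
rewrite /bet; have [k0 H] := weight_inv h; case: ifP => // b.
have [_ {}H] := H b; move: k0; rewrite le_eqVlt => /orP[/eqP <-|k0].
  by rewrite mul0r.
by have [nh Ah] := H k0; rewrite mulr_ge0 ?(ltW k0)// y_ge0.
Qed.

Let bet_super h : \sum_(t : T) bet (t :: h) <= #|T|%:R * bet h.
Proof.
have cstT (r : R) : #|T|%:R * r = \sum_(t : T) r by rewrite sumr_const mulr_natl.
have := weight_inv h; have := bet_ge0 h; rewrite {1 3}/bet.
case: (ltnP (size h) n1) => nh.
  suff -> : weight h = (1, false).
    by move=> _ _; rewrite cstT; apply: ler_sum => t _; rewrite /bet/= nh.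
  by case: h nh => //= t h' nh; rewrite (ltn_trans _ nh).
case wh : (weight h) => [k b] /= bh [k0 Hb].
have k'0 t : 0 <= (if A (t :: h) then k else 0) <= k.
  by case: ifP; rewrite lexx// k0.
case: b wh bh Hb => [|] wh bh Hb; last first.
  rewrite cstT; apply: ler_sum => t _; have /andP[k1 k2] := k'0 t.
  rewrite /bet /= wh ltnNge nh /=.
  case: (leP (y (t :: h)) 2^-1) => y12 /=; last exact: k2.
  by apply: le_trans k2; rewrite mulrAC -[leRHS]mul1r ler_wpM2r//; lra.
have [y1 HA] := Hb isT; have /andP[c0 c1] := c01 (size h).
have c1' : 0 < 1 - c (size h) by rewrite subr_gt0.
move: k0; rewrite le_eqVlt => /orP[/eqP k0|k0].
  rewrite -k0 mul0r mulr0 big1// => t _; rewrite /bet /= wh ltnNge nh /= -k0.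
  by rewrite if_same !mul0r if_same.
have [nh' Ah] := HA k0.
have kc0 : 0 < k / (1 - c (size h)) by rewrite divr_gt0.
apply: (@le_trans _ _ (\sum_t (k / (1 - c (size h))) *
    (if A (t :: h) then y (t :: h) else 0))).
  apply: ler_sum => t _; rewrite /bet /= wh ltnNge nh /=.
  case: (A (t :: h)); last by rewrite !mul0r mulr0 if_same.
  (* Leaving the bet at y >= 1 keeps the stake, which is at most stake * y. *)
  by case: (ltP (y (t :: h)) 1) => // y1'; rewrite ler_peMr// ltW.
rewrite -mulr_sumr; apply: (le_trans (ler_wpM2l (ltW kc0) (y_super nh' Ah y1))).
rewrite le_eqVlt; apply/orP; left; apply/eqP.
by field; rewrite gt_eqF.
Qed.

(** Let y be nonnegative on the nodes where A holds, and in mean over the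
    children where A holds contracted by 1 - c at the nodes where y < 1.  Almost
    surely, on the branches along which A holds from time n1 on, either y exceeds
    1/2 eventually or y tends to 0.  Nothing is required of y where y >= 1. *)
Lemma supermartingale_dichotomy : {ae P, forall w,
  (forall n, (n1 < n)%N -> A (history Us n w)) ->
  (forall N, exists2 n, (N <= n)%N & y (history Us n w) <= 2^-1) ->
  (fun n => y (history Us n w)) @ \oo --> 0}.
Proof.
have max (L : nat) := @supermartingale_maximal _ _ _ P T Us cylinder_measurable
  cylinder_prob T_gt0 bet L.+1%:R (ltr0Sn _ _) bet_ge0 bet_super.
exists (\bigcap_L [set w | exists n, L.+1%:R <= bet (history Us n w)]); split.
- by apply: bigcapT_measurable => L; case: (max L).
- apply/eqP; rewrite eq_le measure_ge0 andbT; apply/lee_addgt0Pr => e e0.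
  rewrite add0e; have [mL PL] := max (Num.truncn e^-1).
  apply: (@le_trans _ _ (P [set w | exists n,
      ((Num.truncn e^-1).+1%:R <= bet (history Us n w))%R])).
    apply: le_measure; rewrite ?inE//.
      by apply: bigcapT_measurable => L; case: (max L).
    by move=> w /(_ (Num.truncn e^-1) I).
  apply: (le_trans PL); rewrite lee_fin /bet/= mul1r.
  rewrite invf_ple ?posrE//; exact/ltW/truncnS_gt.
- move=> w /= H L _; apply: contrapT => HL; apply: H => Aw io.
  apply: (@excursions_cvg0 R c (fun n => (weight (history Us n w)).1)
    (fun n => y (history Us n w)) (fun n => (weight (history Us n w)).2)
    n1 L.+1%:R) => //.
  + by case n1E: (n1) => [|n] //=; rewrite size_history n1E ltnSn.
  + move=> n nn /=; rewrite size_history ltnNge nn/=.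
    have := Aw n.+1 nn; rewrite /= => ->.
    by case: (weight _) => k [] //=; case: (y _ <= _).
  + move=> n; rewrite ltNge; apply/negP => Hn; apply: HL; exists n.
    by rewrite /bet; move: Hn; case: ifP.
  + by move=> n nn; apply: y_ge0; rewrite ?size_history//; exact: Aw.
Qed.

End dichotomy.

(** * The law of independent uniform batches *)
Section uniform_batches.
Context (R : realType) (n M : nat).
Local Notation T := (M.-tuple 'I_n.+1).

Lemma measurable_batch_set (A : set T) : measurable A.
Proof.
have -> : A = \bigcup_(u in A) [set u].
  by rewrite bigcup_imset1 image_id.
apply: fin_bigcup_measurable => [|u _]; first exact: finite_finset.
have -> : [set u] = \bigcap_(i in [set: 'I_M])
    ((@tnth _ _ ^~ i) @^-1` [set tnth u i] : set T).
  apply/seteqP; split => [v -> //|v uv].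
  by apply: eq_from_tnth => i; exact: uv.
apply: fin_bigcap_measurable => [|i _]; first exact: finite_finset.
rewrite -[X in measurable X]setTI; exact: measurable_tnth.
Qed.

Lemma batch_prob (dO : measure_display) (Omega : measurableType dO)
    (P : probability Omega R) (U : {RV P >-> T}) (u : T) :
  independent_uniform U ->
  P (U @^-1` [set u]) = ((#|{: T}|%:R : R)^-1)%:E.
Proof.
move=> [ind unif].
have -> : U @^-1` [set u] = \bigcap_(i in [set` [fset i | i in 'I_M]%fset])
    ((fun w => tnth (U w) i) @^-1` [set tnth u i]).
  apply/seteqP; split => [w /= Uu i _ /=|w Hw /=]; first by rewrite Uu.
  by apply: eq_from_tnth => i; apply: Hw; rewrite /= inE.
rewrite (ind [fset i | i in 'I_M]%fset (fun i => [set tnth u i]))//.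
under eq_bigr => i _ do
  rewrite [X in P X](_ : _ = [set w | tnth (U w) i = tnth u i])// unif.
rewrite prodEFin big_const_seq count_predT.
have -> : size (enum_fset [fset i | i in 'I_M]%fset) = M.
  by rewrite card_imfset//= size_enum_ord.
by rewrite card_tuple card_ord -Monoid.iteropE natrX -exprVn.
Qed.

Context (dO' dO : measure_display) (Omega' : measurableType dO')
  (P' : probability Omega' R) (U : {RV P' >-> T})
  (Omega : measurableType dO) (P : probability Omega R)
  (Us : nat -> {RV P >-> T}).
Hypothesis unifU : independent_uniform U.
Hypothesis iidU : iid_copies U Us.

Local Notation Uf := (fun k w => (Us k : Omega -> T) w).

Let historyE w k : history Uf k w = rev (mkseq (fun i => Us i w) k).
Proof.
elim: k => //= k ->; by rewrite mkseqS rev_rcons.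
Qed.

Let cylinderE u0 h : cylinder Uf h =
  \bigcap_(k in [set` [fset k | k in iota 0 (size h)]%fset])
    (Us k @^-1` [set nth u0 (rev h) k]).
Proof.
rewrite /cylinder; apply/seteqP; split => [w /= hw k /=|w Hw /=].
  rewrite inE/= mem_iota/= add0n => kh.
  by rewrite -hw historyE revK nth_mkseq.
rewrite historyE -[RHS]revK; congr rev.
apply: (@eq_from_nth _ u0); first by rewrite size_rev size_mkseq.
rewrite size_mkseq => i ih; rewrite nth_mkseq//; apply: (Hw i).
by rewrite /= inE/= mem_iota.
Qed.

Lemma batch_cylinder_measurable h : measurable (cylinder Uf h).
Proof.
rewrite (cylinderE [tuple ord0 | i < M]); apply: fin_bigcap_measurable => [|k _].
  exact: finite_fset.
by apply: measurable_funPTI; exact: measurable_batch_set.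
Qed.

Lemma batch_cylinder_prob h :
  P (cylinder Uf h) = ((#|{: T}|%:R ^- size h)%:E : \bar R).
Proof.
have [ind law] := iidU; set u0 : T := [tuple ord0 | i < M].
rewrite (cylinderE u0) (ind _ (fun k => [set nth u0 (rev h) k])); last first.
  by move=> k; exact: measurable_batch_set.
have E k : P (Us k @^-1` [set nth u0 (rev h) k]) = ((#|{: T}|%:R : R)^-1)%:E.
  have := law k [set nth u0 (rev h) k] (measurable_batch_set _).
  by rewrite /distribution/= /pushforward (batch_prob _ unifU).
under eq_bigr => k _ do rewrite E.
rewrite prodEFin big_const_seq count_predT.
have -> : size (enum_fset [fset k | k in iota 0 (size h)]%fset) = size h.
  by rewrite card_imfset//= undup_id ?iota_uniq// size_iota.
by rewrite -Monoid.iteropE -exprVn.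
Qed.

End uniform_batches.

(** * Euclidean inner product *)
Section euclidean.
Context (R : realType) (d : nat).
Implicit Types (x y z : 'rV[R]_d) (a s : R).

(** Euclidean inner product and squared Euclidean norm on row vectors. *)
Definition dot x y : R := \sum_(j < d) x 0 j * y 0 j.
Definition sqn x : R := dot x x.

Lemma dotC x y : dot x y = dot y x.
Proof. by apply: eq_bigr => j _; rewrite mulrC. Qed.

Lemma dotDl x y z : dot (x + y) z = dot x z + dot y z.
Proof. by rewrite -big_split; apply: eq_bigr => j _; rewrite mxE mulrDl. Qed.

Lemma dotDr x y z : dot x (y + z) = dot x y + dot x z.
Proof. by rewrite dotC dotDl !(dotC x). Qed.

Lemma dotZl a x y : dot (a *: x) y = a * dot x y.
Proof. by rewrite mulr_sumr; apply: eq_bigr => j _; rewrite mxE mulrA. Qed.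

Lemma dotZr a x y : dot x (a *: y) = a * dot x y.
Proof. by rewrite dotC dotZl dotC. Qed.

Lemma dotNl x y : dot (- x) y = - dot x y.
Proof. by rewrite -scaleN1r dotZl mulN1r. Qed.

Lemma dotNr x y : dot x (- y) = - dot x y.
Proof. by rewrite dotC dotNl dotC. Qed.

Lemma dot_suml (I : finType) (F : I -> 'rV[R]_d) y :
  dot (\sum_i F i) y = \sum_i dot (F i) y.
Proof.
rewrite /dot exchange_big; apply: eq_bigr => j _ /=.
by rewrite summxE mulr_suml.
Qed.

Lemma dot_sumr (I : finType) (F : I -> 'rV[R]_d) y :
  dot y (\sum_i F i) = \sum_i dot y (F i).
Proof. by rewrite dotC dot_suml; apply: eq_bigr => i _; rewrite dotC. Qed.

Lemma sqnE x : sqn x = \sum_(j < d) x 0 j ^+ 2.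
Proof. by []. Qed.

Lemma sqn_ge0 x : 0 <= sqn x.
Proof. by rewrite sqnE; apply: sumr_ge0 => j _; rewrite sqr_ge0. Qed.

Lemma enorm_sqr x : enorm x ^+ 2 = sqn x.
Proof. by rewrite sqr_sqrtr// sqn_ge0. Qed.

Lemma enorm_ge0 x : 0 <= enorm x. Proof. exact: sqrtr_ge0. Qed.

Lemma enorm_le x a : 0 <= a -> (enorm x <= a) = (sqn x <= a ^+ 2).
Proof. by move=> a0; rewrite -enorm_sqr ler_sqr// nnegrE enorm_ge0. Qed.

Lemma sqnZ a x : sqn (a *: x) = a ^+ 2 * sqn x.
Proof. by rewrite /sqn dotZl dotZr mulrA. Qed.

Lemma sqnN x : sqn (- x) = sqn x.
Proof. by rewrite /sqn dotNl dotNr opprK. Qed.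

Lemma sqnD x y : sqn (x + y) = sqn x + 2 * dot x y + sqn y.
Proof. by rewrite /sqn dotDl !dotDr (dotC y x); ring. Qed.

(** Young's inequality, which replaces the Cauchy-Schwarz inequality throughout:
    it needs no square roots. *)
Lemma dot_young x y s : 0 < s -> dot x y <= (sqn x / s + s * sqn y) / 2.
Proof.
move=> s0; have := sqn_ge0 (x - s *: y).
rewrite sqnD sqnN sqnZ dotNr dotZr => h.
rewrite -(ler_pM2l s0); suff -> : s * ((sqn x / s + s * sqn y) / 2) =
  (sqn x + s ^+ 2 * sqn y) / 2 by lra.
by field; rewrite gt_eqF.
Qed.

Lemma sqn_convex a x y : 0 <= a <= 1 ->
  sqn (a *: x + (1 - a) *: y) <= a * sqn x + (1 - a) * sqn y.
Proof.
move=> /andP[a0 a1]; rewrite sqnD !sqnZ dotZl dotZr.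
have := sqn_ge0 (x - y); rewrite sqnD sqnN dotNr => h.
have h2 : 0 <= a * (1 - a) by rewrite mulr_ge0// subr_ge0.
by have := mulr_ge0 h2 h; nra.
Qed.

Lemma sqn_sum (I : finType) (F : I -> 'rV[R]_d) :
  sqn (\sum_i F i) <= #|I|%:R * \sum_i sqn (F i).
Proof.
rewrite {1}/sqn dot_suml.
apply: (@le_trans _ _ (\sum_i \sum_j (sqn (F i) + sqn (F j)) / 2)).
  apply: ler_sum => i _; rewrite dot_sumr; apply: ler_sum => j _.
  by apply: (le_trans (dot_young _ _ ltr01)); rewrite divr1 mul1r.
set S := \sum_i sqn (F i); set N : R := #|I|%:R.
have cstI (r : R) : \sum_(i : I) r = N * r by rewrite sumr_const mulr_natl.
have inner i : \sum_j (sqn (F i) + sqn (F j)) / 2 = (N * sqn (F i) + S) / 2.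
  by rewrite -mulr_suml big_split/= cstI.
under eq_bigr => i _ do rewrite inner.
rewrite -mulr_suml big_split/= cstI -mulr_sumr -/S; lra.
Qed.

Lemma sqr_coord_le x j : x 0 j ^+ 2 <= sqn x.
Proof.
rewrite sqnE (bigD1 j)//= lerDl; apply: sumr_ge0 => i _; exact: sqr_ge0.
Qed.

Lemma mx_norm_le_sqn x : `|x| ^+ 2 <= sqn x.
Proof.
rewrite -[leRHS]sqr_sqrtr ?sqn_ge0// ler_sqr ?nnegrE ?sqrtr_ge0//.
rewrite [leLHS]mx_normrE; apply/bigmax_leP; split => [|[i j] _ /=].
  exact: sqrtr_ge0.
by rewrite ord1 -sqrtr_sqr ler_wsqrtr// sqr_coord_le.
Qed.

Lemma sqn_le_mx_norm x : sqn x <= d%:R * `|x| ^+ 2.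
Proof.
rewrite sqnE -[X in X%:R](card_ord d) mulr_natl -sumr_const; apply: ler_sum => j _.
rewrite -[x 0 j ^+ 2]real_normK ?num_real// ler_sqr ?nnegrE//.
rewrite [leRHS]mx_normrE; apply/bigmax_geP; right => /=.
by exists (0, j).
Qed.

End euclidean.

(** * Gradients and the descent inequality *)
Section gradient.
Context (R : realType) (d : nat).
Implicit Types (f : 'rV[R]_d -> R) (x h : 'rV[R]_d).

Lemma derive_grad f x h : differentiable f x -> 'D_h f x = dot (grad f x) h.
Proof.
move=> df; rewrite deriveE// {1}[h]row_sum_delta linear_sum.
apply: eq_bigr => j _; rewrite linearZ/= mxE deriveE//.
by rewrite mulrC.
Qed.

Lemma derivable_segment f x h (t : R) : differentiable f (x + t *: h) ->
  is_derive t 1 (fun s => f (x + s *: h)) (dot (grad f (x + t *: h)) h).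
Proof.
move=> df; rewrite -derive_grad//.
have E : (fun s : R => s^-1 *:
      (((fun s => f (x + s *: h)) \o shift t) (s *: 1) - f (x + t *: h))) =
    (fun s : R => s^-1 *: ((f \o shift (x + t *: h)) (s *: h) - f (x + t *: h))).
  apply/funext => s /=; congr (_ *: (f _ - _)).
  have -> : s *: (1 : R^o) = s by rewrite /GRing.scale/= mulr1.
  by rewrite /= scalerDl addrCA.
apply: DeriveDef.
  by rewrite /derivable E; exact: diff_derivable.
by rewrite /derive E.
Qed.

(** The descent lemma, with the constant L instead of L / 2. *)
Lemma descent f x h (L : R) : (forall z, differentiable f z) -> 0 < L ->
  (forall t : R, 0 <= t <= 1 ->
     sqn (grad f (x + t *: h) - grad f x) <= L ^+ 2 * sqn h) ->
  f (x + h) <= f x + dot (grad f x) h + L * sqn h.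
Proof.
move=> df L0 lip.
have dphi (s : R) := @derivable_segment f x h s (df _).
have cphi : {within `[0, 1 : R], continuous (fun s : R => f (x + s *: h))}.
  by apply: derivable_within_continuous => s _; case: (dphi s).
have [t] := @MVT R (fun s => f (x + s *: h))
  (fun s => dot (grad f (x + s *: h)) h) 0 1 ltr01 (fun s _ => dphi s) cphi.
rewrite in_itv/= => /andP[/ltW t0 /ltW t1].
rewrite scale1r scale0r addr0 subr0 mulr1 => E.
have := @dot_young _ _ (grad f (x + t *: h) - grad f x) h L L0.
rewrite dotDl dotNl -E => Y.
have := lip t; rewrite t0 t1 => /(_ isT) l.
have l' : sqn (grad f (x + t *: h) - grad f x) / L <= L * sqn h.
  by rewrite ler_pdivrMr// mulrAC -expr2.
by move: Y l'; lra.
Qed.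

End gradient.

(** * The empirical risk and its mini-batch gradients *)
Section empirical_risk.
Context (R : realType) (d : nat) (Y : Type) (n M : nat).
Variables (NN : 'rV[R]_d -> Y -> R) (y : 'I_n.+1 -> Y) (z : 'I_n.+1 -> R).
Hypothesis NN_C1 : forall y0, C1 (NN^~ y0).
Hypothesis M_gt0 : (0 < M)%N.
Local Notation T := (M.-tuple 'I_n.+1).
Local Notation loss := (empirical_loss NN y z).
Local Notation X := (@minibatch_gradient R d Y n.+1 M NN y z).

(** Prediction error at the k-th data point, and gradient of the model there. *)
Definition residual (k : 'I_n.+1) (theta : 'rV[R]_d) : R :=
  NN theta (y k) - z k.

Definition model_grad (k : 'I_n.+1) (theta : 'rV[R]_d) : 'rV[R]_d :=
  grad (NN^~ (y k)) theta.

Lemma lossE theta :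
  loss theta = (2 * n.+1%:R)^-1 * \sum_k residual k theta ^+ 2.
Proof.
congr (_ * _); apply: eq_bigr => k _.
by rewrite real_normK ?num_real.
Qed.

Lemma loss_ge0 theta : 0 <= loss theta.
Proof.
rewrite lossE mulr_ge0 ?invr_ge0//; apply: sumr_ge0 => k _; exact: sqr_ge0.
Qed.

Let dNN k (theta : 'rV[R]_d) : differentiable (residual k) theta.
Proof. by apply: differentiableB => //; apply: (NN_C1 (y k)).1. Qed.

Let lossF : loss =
  (2 * n.+1%:R)^-1 \*: (\sum_(k < n.+1) (residual k * residual k)).
Proof.
apply/funext => theta; rewrite lossE /= fct_sumE.
by congr (_ * _); apply: eq_bigr => k _; rewrite expr2.
Qed.

Lemma loss_differentiable theta : differentiable loss theta.
Proof.
rewrite lossF; apply: differentiableZ; apply: differentiable_sum => k.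
exact: differentiableM.
Qed.

Lemma grad_loss theta :
  grad loss theta = n.+1%:R^-1 *: \sum_k residual k theta *: model_grad k theta.
Proof.
apply/rowP => j; rewrite !mxE summxE lossF.
set v := delta_mx 0 j.
have dr k : is_derive theta v (residual k) ('D_v (NN^~ (y k)) theta).
  have h : derivable (NN^~ (y k)) theta v.
    by apply: diff_derivable; apply: (NN_C1 (y k)).1.
  rewrite -['D_v _ _]subr0; apply: is_deriveB; first exact: DeriveDef.
have D := is_deriveZ (2 * n.+1%:R)^-1
  (is_derive_sum (fun k => is_deriveM (dr k) (dr k))).
rewrite (@derive_val _ _ _ _ _ _ _ D).
under [in RHS]eq_bigr => k _ do rewrite !mxE.
rewrite !mulr_sumr [LHS]/GRing.scale/= mulr_sumr; apply: eq_bigr => k _.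
rewrite -/v.
have -> (a b : R) : a *: b = a * b by [].
by field; rewrite nat1r pnatr_eq0.
Qed.

(** Each entry of a uniform batch is uniform.  Translating the i-th entry by all
    the elements of the cyclic group 'I_n.+1 shows it without counting. *)
Lemma sum_batch (V : lmodType R) (W : 'I_n.+1 -> V) (i : 'I_M) :
  n.+1%:R *: \sum_(u : T) W (tnth u i) = #|{: T}|%:R *: \sum_k W k.
Proof.
have shift (a : 'I_n.+1) : \sum_(u : T) W (tnth u i + a) = \sum_(u : T) W (tnth u i).
  rewrite [RHS](reindex (map_tuple (fun k => k + a)%R))/=; last first.
    exists (map_tuple (fun k => k - a)%R) => u _; apply: eq_from_tnth => j;
    by rewrite !tnth_map ?addrK ?subrK.
  by apply: eq_bigr => u _; rewrite tnth_map.
have -> : n.+1%:R *: \sum_(u : T) W (tnth u i) =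
    \sum_(a : 'I_n.+1) \sum_(u : T) W (tnth u i + a).
  by under [RHS]eq_bigr => a _ do rewrite shift; rewrite sumr_const card_ord scaler_nat.
rewrite exchange_big/= scaler_nat -sumr_const; apply: eq_bigr => u _.
rewrite [RHS](reindex (fun a => tnth u i + a)%R)//=.
by exists (fun k => k - tnth u i)%R => k _; rewrite ?subrKC// addrAC subrr add0r.
Qed.

(** The estimator is an unbiased estimator of minus the gradient. *)
Lemma sum_minibatch theta :
  \sum_(u : T) X u theta = - (#|{: T}|%:R *: grad loss theta).
Proof.
rewrite /minibatch_gradient sumrN -scaler_sumr exchange_big/=; congr (- _).
have S i : \sum_(u : T) residual (tnth u i) theta *: model_grad (tnth u i) theta =
    #|{: T}|%:R *: grad loss theta.
  have := sum_batch (fun k => residual k theta *: model_grad k theta) i.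
  move=> /(congr1 (fun v => n.+1%:R^-1 *: v)); rewrite scalerA mulVf// scale1r => ->.
  by rewrite scalerA mulrC -scalerA grad_loss.
under eq_bigr => i _ do rewrite (S i).
rewrite sumr_const card_ord -scalerMnr scalerMnl -mulr_natr mulVf ?scale1r//.
by rewrite pnatr_eq0 -lt0n.
Qed.

(** In the interpolation regime the noise is controlled by the risk. *)
Lemma minibatch_sqn_le theta (B : R) : (forall k, sqn (model_grad k theta) <= B) ->
  forall u : T, sqn (X u theta) <= 2 * n.+1%:R * B * loss theta.
Proof.
move=> HB u; rewrite sqnN sqnZ.
have B0 : 0 <= B := le_trans (sqn_ge0 _) (HB ord0).
have M0 : (0 : R) < M%:R by rewrite ltr0n.
set S := \sum_k residual k theta ^+ 2.
have -> : 2 * n.+1%:R * B * loss theta = B * S.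
  by rewrite lossE -/S; field; rewrite nat1r pnatr_eq0.
rewrite exprVn ler_pdivrMl ?exprn_gt0//.
apply: (le_trans (sqn_sum _)); rewrite card_ord expr2 -mulrA ler_pM2l//.
rewrite -[in leRHS](card_ord M) mulr_natl -sumr_const; apply: ler_sum => i _.
rewrite sqnZ mulrC ler_pM ?sqn_ge0 ?sqr_ge0//; first exact: HB.
rewrite /S (bigD1 (tnth u i))//= lerDl; apply: sumr_ge0 => k _; exact: sqr_ge0.
Qed.

End empirical_risk.

(** * Local Lipschitz continuity of the estimator *)
Section regularity.
Context (R : realType) (n M d : nat).
Local Notation T := (M.-tuple 'I_n.+1).

(** Every batch has the same positive probability, so a p-th moment bound on the
    increments is a bound for each batch separately. *)
Lemma regular_batch_lipschitz (dO : measure_display)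
    (Omega : measurableType dO) (P : probability Omega R) (p rho : R)
    (X : T -> 'rV[R]_d -> 'rV[R]_d) (U : {RV P >-> T}) :
  0 < p -> independent_uniform U -> locally_regular p X U ->
  exists2 L : R, 0 < L & forall (u : T) x y, enorm x <= rho -> enorm y <= rho ->
    enorm (X u x - X u y) <= L * enorm (x - y).
Proof.
move=> p0 unif [c cc reg].
have [rho0|rho0] := ltP rho 0.
  exists 1 => // u x y xr; have := enorm_ge0 x => /le_trans/(_ xr).
  by rewrite leNgt rho0.
have [a _ ca] := @EVT_max R c 0 (rho + rho) (addr_ge0 rho0 rho0)
  (continuous_subspaceT cc).
pose C : R := `|c a| + 1.
have C0 : 0 < C by rewrite ltr_pwDr.
have N0 : (0 : R) < #|{: T}|%:R by rewrite card_tuple card_ord ltr0n expn_gt0.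
exists ((#|{: T}|%:R * C) `^ p^-1); first by rewrite powR_gt0// mulr_gt0.
move=> u x y xr yr.
set e1 := enorm (X u x - X u y); set e2 := enorm (x - y).
have e20 : 0 <= e2 := enorm_ge0 _.
have e10 : 0 <= e1 := enorm_ge0 _.
suff e12 : e1 `^ p <= #|{: T}|%:R * C * e2 `^ p.
  rewrite leNgt; apply/negP => lt12; move: e12; apply/negP; rewrite -ltNge.
  rewrite (_ : _ * C * _ = ((#|{: T}|%:R * C) `^ p^-1 * e2) `^ p).
    by apply: gt0_ltr_powR => //; rewrite nnegrE// mulr_ge0// powR_ge0.
  rewrite powRM ?powR_ge0// -powRrM mulVf ?gt_eqF// powRr1//.
  by rewrite mulr_ge0// ltW.
rewrite -[leRHS]mulrA -(ler_pdivrMl _ _ N0) -lee_fin.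
have [_ h] := reg x y.
have cle : c (enorm x + enorm y) <= C.
  apply: (le_trans (ca _ _)); last by rewrite (le_trans (ler_norm _))// lerDl.
  by rewrite in_itv/= addr_ge0 ?enorm_ge0// lerD.
apply: (@le_trans _ _ (c (enorm x + enorm y) * e2 `^ p)%:E); last first.
  by rewrite lee_fin ler_wpM2r// powR_ge0.
apply: le_trans h; rewrite expectation.unlock.
have mU (g : T -> \bar R) : measurable_fun setT (fun w => g (U w)).
  move=> _ Y mY; rewrite setTI.
  exact: (measurable_funPTI U (measurable_batch_set (g @^-1` Y))).
pose A := U @^-1` [set u].
have mA : measurable A by apply: measurable_funPTI; exact: measurable_batch_set.
apply: (@le_trans _ _ (\int[P]_(w in A) (enorm (X (U w) x - X (U w) y) `^ p)%:E)%E).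
  rewrite (eq_integral (fun=> (e1 `^ p)%:E)); last first.
    by move=> w; rewrite inE => Aw; rewrite /e1 Aw.
  have -> : (\int[P]_(w in A) (e1 `^ p)%:E = (e1 `^ p)%:E * P A)%E.
    exact: integral_cst.
  by rewrite /A (batch_prob _ unif) -EFinM mulrC.
apply: ge0_subset_integral => //.
  exact: (mU (fun v : T => (enorm (X v x - X v y) `^ p)%:E)).
by move=> w _; rewrite lee_fin powR_ge0.
Qed.

End regularity.

(** * One-step drift of the Lyapunov function *)
Section lyapunov.
Context (R : realType) (d : nat).
Implicit Types (g m x : 'rV[R]_d).

(** Bound on the Lyapunov function after one step theta -> theta + D, for one
    outcome of the batch: D is gam * sigma * m' coordinatewise and the
    preconditioner sigma is within zeta of its limit value e = eps^-1.  The
    momentum enters linearly through dot g m' only. *)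
Lemma lyapunov_pointwise (r r' gam gam' e zeta L a' b : R)
    (g g' m' D : 'rV[R]_d) (sigma : 'I_d -> R) :
  0 < gam -> gam' <= gam -> 0 < e -> 0 < L -> 0 <= a' -> 0 <= b -> 0 <= zeta ->
  (forall j, D 0 j = gam * sigma j * m' 0 j) ->
  (forall j, 0 <= sigma j <= e) -> (forall j, e - zeta <= sigma j) ->
  r' <= r + dot g D + L * sqn D ->
  sqn (g' - g) <= L ^+ 2 * sqn D ->
  r' + a' * dot g' m' + b * gam' * sqn m' <=
  r + (gam * e + a') * dot g m' + gam * zeta / 2 * sqn g
    + gam * (b + (zeta / 2 + L * (gam * e ^+ 2) + a' * (L * e))) * sqn m'.
Proof.
move=> gam0 gamle e0 L0 a0 b0 z0 DE sb sz r'le g'le.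
have q0 := sqn_ge0 m'.
have sD : sqn D <= (gam * e) ^+ 2 * sqn m'.
  rewrite !sqnE mulr_sumr; apply: ler_sum => j _; rewrite DE.
  have /andP[s0 s1] := sb j; rewrite !exprMn ler_wpM2r ?sqr_ge0// ler_wpM2l ?sqr_ge0//.
  by rewrite ler_sqr ?nnegrE// ltW.
have gD : dot g D <= gam * e * dot g m' + gam * zeta * ((sqn g + sqn m') / 2).
  rewrite !sqnE /dot -big_split/= !mulr_suml !mulr_sumr -[leRHS]big_split/=.
  apply: ler_sum => j _; rewrite DE.
  set u := g 0 j; set v := m' 0 j.
  have /andP[s0 s1] := sb j; have sz' := sz j.
  have uv1 : 0 <= (u + v) ^+ 2 := sqr_ge0 _.
  have uv2 : 0 <= (u - v) ^+ 2 := sqr_ge0 _.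
  suff : (sigma j - e) * (u * v) <= zeta * ((u ^+ 2 + v ^+ 2) / 2).
    by move=> /(ler_wpM2l (ltW gam0)); lra.
  have h1 : (e - sigma j) * (- (u * v)) <= (e - sigma j) * ((u ^+ 2 + v ^+ 2) / 2).
    by rewrite ler_wpM2l//; lra.
  have h2 : (e - sigma j) * ((u ^+ 2 + v ^+ 2) / 2) <= zeta * ((u ^+ 2 + v ^+ 2) / 2).
    by rewrite ler_wpM2r//; have := sqr_ge0 u; have := sqr_ge0 v; lra.
  by lra.
have s0 : 0 < L * (gam * e) by rewrite !mulr_gt0.
have gm : dot g' m' <= dot g m' + L * (gam * e) * sqn m'.
  have Y := dot_young (g' - g) m' s0; rewrite dotDl dotNl in Y.
  have h : sqn (g' - g) / (L * (gam * e)) <= L * (gam * e) * sqn m'.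
    rewrite ler_pdivrMr//; apply: (le_trans g'le).
    apply: (le_trans (ler_wpM2l (sqr_ge0 L) sD)).
    by rewrite le_eqVlt; apply/orP; left; apply/eqP; ring.
  by lra.
have h1 := ler_wpM2l a0 gm.
have h2 := ler_wpM2l (ltW L0) sD.
have h3 : b * gam' * sqn m' <= b * gam * sqn m' by rewrite ler_wpM2r// ler_wpM2l.
apply: (@le_trans _ _ (r + (gam * e * dot g m' + gam * zeta * ((sqn g + sqn m') / 2))
  + L * ((gam * e) ^+ 2 * sqn m')
  + a' * (dot g m' + L * (gam * e) * sqn m') + b * gam * sqn m')); first by lra.
by rewrite le_eqVlt; apply/orP; left; apply/eqP; field.
Qed.

(** Average of the previous bound over the batches.  Since m' = al m + (1 - al) x
    and x averages to - g, the mean of dot g m' is al (dot g m) - (1 - al) |g|^2;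
    the relation between a and a' makes the terms in dot g m cancel.  The
    conditions on zeta, b and k make the error terms leave a fixed fraction of the
    gain (1 - al) e gam |g|^2. *)
Lemma lyapunov_drift (T : finType) (r gam e zeta L a a' b c al B mu : R)
    (g m : 'rV[R]_d) (x m' : T -> 'rV[R]_d) (psi' : T -> R) :
  let k := zeta / 2 + L * (gam * e ^+ 2) + a' * (L * e) in
  0 < gam <= 1 -> 0 < e -> 0 <= al < 1 -> 0 < mu -> 0 <= b -> 0 <= a' -> 0 <= r ->
  0 <= zeta -> 0 <= L -> 0 <= B ->
  a = al * (gam * e + a') ->
  \sum_t x t = - (#|T|%:R *: g) ->
  (forall t, m' t = al *: m + (1 - al) *: x t) ->
  (forall t, sqn (x t) <= B * r) ->
  2 * mu * r <= sqn g ->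
  (forall t, psi' t <=
     r + (gam * e + a') * dot g (m' t) + gam * zeta / 2 * sqn g
       + gam * (b + k) * sqn (m' t)) ->
  zeta <= (1 - al) * e ->
  b * ((1 - al) * B) <= (1 - al) * e * mu / 4 ->
  k * ((1 - al) * B) <= (1 - al) * e * mu / 4 ->
  k * al <= b * (1 - al) / 2 ->
  `|a * dot g m| <= (r + b * gam * sqn m) / 2 ->
  0 <= c -> c <= (1 - al) * e * mu / 4 -> c <= (1 - al) / 4 ->
  \sum_t psi' t <=
    #|T|%:R * ((1 - c * gam) * (r + a * dot g m + b * gam * sqn m)).
Proof.
move=> k /andP[gam0 gam1] e0 /andP[al0 al1] mu0 b0 a'0 r0 z0 L0 B0 aE sx m'E xB PL
  psi'le H1 H2 H3 H4 H5 c0 c1 c2.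
have cstT (s : R) : #|T|%:R * s = \sum_(t : T) s by rewrite sumr_const mulr_natl.
have k0 : 0 <= k.
  by rewrite /k !addr_ge0 ?mulr_ge0 ?sqr_ge0 ?invr_ge0// ltW.
set q := sqn m in H5 *; set G := sqn g in PL psi'le *.
set cc := dot g m in H5 *.
have q0 : 0 <= q := sqn_ge0 _.
pose A0 := r + gam * zeta / 2 * G + gam * (b + k) * (al * q + (1 - al) * (B * r)).
apply: (@le_trans _ _ (\sum_(t : T) A0
    + (gam * e + a') * dot g (\sum_t m' t))).
  rewrite dot_sumr [X in _ <= _ + X]mulr_sumr -[leRHS]big_split/=.
  apply: ler_sum => t _; apply: (le_trans (psi'le t)); rewrite /A0.
  have : sqn (m' t) <= al * q + (1 - al) * (B * r).
    rewrite m'E; apply: (le_trans (sqn_convex _ _ _)); first by rewrite al0 ltW.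
    by rewrite lerD2l ler_wpM2l// subr_ge0 ltW.
  move=> /(ler_wpM2l (mulr_ge0 (ltW gam0) (addr_ge0 b0 k0))).
  by lra.
have -> : dot g (\sum_t m' t) = #|T|%:R * (al * cc - (1 - al) * G).
  under eq_bigr => t _ do rewrite m'E.
  rewrite big_split/= sumr_const -scaler_sumr sx dotDr dotZr dotNr dotZr.
  rewrite -scaler_nat !dotZr.
  by rewrite /cc /G /sqn; ring.
have -> (W : R) : \sum_(t : T) A0 + (gam * e + a') * (#|T|%:R * W) =
    #|T|%:R * (A0 + (gam * e + a') * W).
  by rewrite -cstT; ring.
rewrite ler_wpM2l// /A0.
have hG : gam * ((1 - al) * e) * (2 * mu * r) <= gam * ((1 - al) * e) * G.
  by rewrite ler_wpM2l// !mulr_ge0 ?subr_ge0// ltW.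
have G0 : 0 <= G := sqn_ge0 _.
have h1 : gam * G * zeta <= gam * G * ((1 - al) * e).
  by rewrite ler_wpM2l// mulr_ge0// ltW.
have h2 : gam * r * (b * ((1 - al) * B)) <= gam * r * ((1 - al) * e * mu / 4).
  by rewrite ler_wpM2l// mulr_ge0// ltW.
have h3 : gam * r * (k * ((1 - al) * B)) <= gam * r * ((1 - al) * e * mu / 4).
  by rewrite ler_wpM2l// mulr_ge0// ltW.
have h4 : gam * q * (k * al) <= gam * q * (b * (1 - al) / 2).
  by rewrite ler_wpM2l// mulr_ge0// ltW.
have h5 : 0 <= a' * ((1 - al) * G) by rewrite !mulr_ge0// subr_ge0 ltW.
have ac : a * cc <= (r + b * gam * q) / 2 by apply: le_trans H5; exact: ler_norm.
have h6 : c * gam * (a * cc) <= c * gam * ((r + b * gam * q) / 2).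
  by rewrite ler_wpM2l// mulr_ge0// ltW.
have h7 : gam * r * c <= gam * r * ((1 - al) * e * mu / 4).
  by rewrite ler_wpM2l// mulr_ge0// ltW.
have h8 : gam * (b * q) * (c * gam) <= gam * (b * q) * ((1 - al) / 4 * 1).
  by rewrite ler_wpM2l ?mulr_ge0 ?(ltW gam0)// ler_pM// ltW.
have aE' : (gam * e + a') * (al * cc) = a * cc by rewrite aE; ring.
have rmu : 0 <= gam * r * ((1 - al) * e * mu).
  by rewrite !mulr_ge0 ?subr_ge0// ltW.
have qb : 0 <= gam * q * (b * (1 - al)).
  by rewrite !mulr_ge0 ?subr_ge0// ltW.
rewrite mulrBr aE'.
by lra.
Qed.

End lyapunov.

(** * Compactness *)
Section compactness.
Context (R : realType) (V : normedModType R).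

(** A property of a radius and a point that holds locally for all small radii
    holds on a compact set for a common radius. *)
Lemma compact_uniform_radius (A : set V) (Q : R -> V -> Prop) :
  compact A ->
  (forall x, A x -> exists2 e : R, 0 < e &
     forall x' r, `|x' - x| < e -> 0 < r < e -> Q r x') ->
  exists2 r : R, 0 < r & forall x, A x -> Q r x.
Proof.
move=> /compact_near_coveringP cA H.
have H' : \forall r \near (0 : R)^'+, A `<=` Q r.
  apply: (cA R) => x Ax; have [e e0 He] := H x Ax.
  exists (ball x e, [set r | 0 < r < e]) => /=.
    split; first exact: nbhsx_ballx.
    near=> r; apply/andP; split; first by near: r; exact: nbhs_right_gt.
    by near: r; exact: nbhs_right_lt.
  move=> [x' r] /= [xx' r0]; apply: He => //.
  by rewrite distrC; move: xx'; rewrite -ball_normE.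
have [r [r0 Hr]] := filter_ex (filterI (nbhs_right_gt (0 : R)) H').
by exists r.
Unshelve. all: by end_near.
Qed.

Lemma compact_uniformly_continuous (A : set V) (f : V -> R) (e : R) :
  compact A -> continuous f -> 0 < e ->
  exists2 r : R, 0 < r & forall x y, A x -> `|x - y| <= r -> f y <= f x + e.
Proof.
move=> cA cf e0.
have [|r r0 H] := @compact_uniform_radius A
    (fun r x => forall y, `|x - y| <= r -> f y <= f x + e) cA.
  move=> x Ax; have e2 : 0 < e / 2 by lra.
  have /cvgrPdist_lt/(_ _ e2)/nbhs_ballP[s /= s0 Hs] := cf x.
  exists (s / 2) => [|x' r xx' /andP[_ rs] y x'y]; first by lra.
  have h1 : `|f x - f x'| < e / 2.
    apply: Hs; rewrite -ball_normE/= distrC; lra.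
  have h2 : `|f x - f y| < e / 2.
    apply: Hs; rewrite -ball_normE/= -(subrKA x').
    apply: (le_lt_trans (ler_normD _ _)); rewrite (distrC x x'); lra.
  by move: h1 h2; rewrite !ltr_norml => /andP[? ?] /andP[? ?]; lra.
by exists r => // x y' Ax; exact: H.
Qed.

(** When the zeros in D of a nonnegative f all lie in C, the points of K near
    C `&` K where f is small are close to C `&` K. *)
Lemma zero_set_isolated (f : V -> R) (C K D : set V) :
  continuous f -> (forall x, 0 <= f x) -> compact (C `&` K) -> compact K ->
  set_nbhs (C `&` K) D -> (forall x, D x -> f x = 0 -> C x) ->
  exists2 r : R, 0 < r &
    (forall c x, (C `&` K) c -> `|x - c| <= r -> D x) /\
    (forall O, open O -> C `&` K `<=` O -> exists2 l : R, 0 < l &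
      forall x, K x -> (exists2 c, (C `&` K) c & `|x - c| <= r) ->
        f x < l -> O x).
Proof.
move=> cf f0 cA cK nD DC.
have [|r0 r00 Hr0] := @compact_uniform_radius (C `&` K)
    (fun r c => forall x, `|x - c| < r -> D x) cA.
  move=> c Ac; have /nbhs_ballP[s /= s0 Hs] := nD c Ac.
  exists (s / 2) => [|x' r xx' /andP[_ rs] y x'y]; first by lra.
  apply: Hs; rewrite -ball_normE/= distrC -(subrKA x').
  by apply: (le_lt_trans (ler_normD _ _)); lra.
exists (r0 / 2); first by lra.
split=> [c x Ac xc|O oO AO]; first by apply: (Hr0 c) => //; lra.
have [|l l0 Hl] := @compact_uniform_radius K
    (fun l x => (exists2 c, (C `&` K) c & `|x - c| <= r0 / 2) -> f x < l -> O x) cK.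
  move=> x Kx; have := f0 x; rewrite le_eqVlt => /orP[/eqP fx0|fx0]; last first.
    have fx2 : 0 < f x / 2 by lra.
    have /cvgrPdist_lt/(_ _ fx2)/nbhs_ballP[s /= s0 Hs] := cf x.
    exists (Num.min s (f x / 2)) => [|x' l]; first by rewrite lt_min s0.
    rewrite lt_min => /andP[xx' _] /andP[_]; rewrite lt_min => /andP[_ lf] _ fl.
    have := Hs x'; rewrite -ball_normE/= distrC => /(_ xx').
    by rewrite ltr_norml => /andP[? ?]; lra.
  (* A zero of f in K outside C is not in D, hence is at distance at least r0 of
     C `&` K, so that no point near it is within r0 / 2 of C `&` K. *)
  have [Cx|nCx] := pselect (C x).
    have /nbhs_ballP[s /= s0 Hs] : nbhs x O.
      by apply: open_nbhs_nbhs; split => //; exact: AO.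
    exists s => // x' l xx' _ _ _; apply: Hs.
    by rewrite -ball_normE/= distrC.
  exists (r0 / 2) => [|x' l xx' _ [c Ac cx'] _]; first by lra.
  exfalso; apply: nCx; apply: DC => //; apply: (Hr0 c) => //.
  rewrite -(subrKA x'); apply: (le_lt_trans (ler_normD _ _)).
  by rewrite (distrC x x'); lra.
by exists l.
Qed.

End compactness.

(** * Scalar sequences *)
Section scalar_sequences.
Context (R : realType).

(** s k = \sum_i al^i * gamma (k + i), through the recursion that it satisfies. *)
Lemma discounted_sum (al : R) (gamma : nat -> R) :
  0 <= al < 1 -> (forall k, 0 < gamma k) -> nonincreasing_seq gamma ->
  exists s : nat -> R, forall k,
    0 <= s k <= gamma k / (1 - al) /\ s k = gamma k + al * s k.+1.
Proof.
move=> /andP[al0 al1] g0 gd.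
pose u n k := al ^+ k * gamma (n + k)%N.
have u0 n k : 0 <= u n k by rewrite mulr_ge0 ?exprn_ge0// ltW.
have ug n k : u n k <= geometric (gamma n) al k.
  by rewrite /u /= [leRHS]mulrC ler_wpM2l ?exprn_ge0// gd// leq_addr.
have al1' : `|al| < 1 by rewrite ger0_norm.
have cg n := @is_cvg_geometric_series _ (gamma n) _ al1'.
have cu n : cvgn (series (u n)).
  apply: series_le_cvg (cg n) => // k.
  by rewrite /= mulr_ge0 ?exprn_ge0// ltW.
exists (fun n => limn (series (u n))) => n; split.
  apply/andP; split.
    by apply: limr_ge => //; apply: nearW => k; apply: sumr_ge0.
  rewrite -(cvg_lim _ (cvg_geometric_series (a := gamma n) al1'))//.
  by apply: ler_lim => //; apply: nearW => k; apply: ler_sum.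
have rec k : series (u n) k.+1 = gamma n + al * series (u n.+1) k.
  rewrite /series/= big_nat_recl// /u expr0 mul1r addn0 mulr_sumr; congr (_ + _).
  by apply: eq_bigr => i _; rewrite exprS mulrA addnS addSn.
have c1 : (fun k => series (u n) k.+1) @ \oo --> limn (series (u n)).
  rewrite (cvg_shiftS (series (u n))); exact: cu.
have c2 : (fun k => series (u n) k.+1) @ \oo --> gamma n + al * limn (series (u n.+1)).
  under eq_fun do rewrite rec.
  by apply: cvgD; [exact: cvg_cst|apply: cvgMl_tmp; exact: cu].
exact: (cvg_unique _ c1 c2).
Qed.

Lemma nonneg_series_unbounded (gamma : nat -> R) : (forall k, 0 <= gamma k) ->
  ~ cvgn (series gamma) -> forall B : R, exists n, B <= \sum_(i < n) gamma i.
Proof.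
move=> g0 nc B; apply: contrapT => H; apply: nc.
apply: nondecreasing_is_cvgn.
  apply/nondecreasing_seqP => n; rewrite /series/= big_nat_recr//= lerDl; exact: g0.
exists B => _ [n _ <-]; rewrite leNgt; apply/negP => Bn; apply: H; exists n.
by rewrite -(big_mkord xpredT) ltW.
Qed.

Lemma contraction_iter (u : nat -> R) (rho B : R) n k : 0 <= rho <= 1 ->
  (forall i, (i < k)%N -> u (n + i.+1)%N <= rho * u (n + i)%N + (1 - rho) * B) ->
  u (n + k)%N - B <= rho ^+ k * (u n - B).
Proof.
move=> /andP[r0 r1]; elim: k => [|k IH] H; first by rewrite addn0 expr0 mul1r.
have := IH (fun i ik => H i (ltnW ik)) => /(ler_wpM2l r0).
have := H k (ltnSn k); rewrite exprS -mulrA; lra.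
Qed.

Lemma contraction_eventually (u : nat -> R) (rho B e : R) n0 : 0 <= rho < 1 ->
  0 < e -> (forall n, (n0 <= n)%N -> u n.+1 <= rho * u n + (1 - rho) * B) ->
  exists n1, forall n, (n1 <= n)%N -> u n <= B + e.
Proof.
move=> /andP[r0 r1] e0 H.
have [N _ HN] : \forall k \near \oo, rho ^+ k * (u n0 - B) <= e.
  have : (fun k => (u n0 - B) * rho ^+ k) @ \oo --> 0.
    by have := @cvg_geometric _ (u n0 - B) rho; rewrite ger0_norm// => /(_ r1).
  move=> /cvgrPdist_le/(_ _ e0); apply: filterS => k.
  by rewrite sub0r normrN mulrC => /(le_trans (ler_norm _)).
exists (n0 + N)%N => n nN.
have := @contraction_iter u rho B n0 (n - n0)%N; rewrite r0 ltW//.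
have n0n : (n0 <= n)%N := leq_trans (leq_addr _ _) nN.
rewrite subnKC// => /(_ isT) h.
have Nn : (N <= n - n0)%N by rewrite leq_subRL.
have h2 := HN (n - n0)%N Nn.
have : u n - B <= rho ^+ (n - n0) * (u n0 - B).
  by apply: h => i _; rewrite addnS; apply: H; exact: leq_addr.
by move: h2 => /=; lra.
Qed.

End scalar_sequences.

(** * The preconditioner of Adam *)
Section adam_preconditioner.
Context (R : realType) (d : nat) (beta eps : R).
Hypothesis beta01 : 0 <= beta < 1.
Hypothesis eps0 : 0 < eps.

Lemma adam_sigma_bounds k (v : 'rV[R]_d) j :
  0 <= adam_sigma beta eps k v j <= eps^-1.
Proof.
rewrite /adam_sigma; set s := Num.sqrt _.
have s0 : 0 <= s := sqrtr_ge0 _.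
by rewrite invr_ge0 addr_ge0 ?(ltW eps0)//= lef_pV2 ?posrE ?lerDr// ltr_wpDl.
Qed.

(** The preconditioner is close to eps^-1 when v is small. *)
Lemma adam_sigma_ge k (v : 'rV[R]_d) j (zeta : R) : 0 <= zeta ->
  v 0 j <= (1 - beta) * (zeta * eps ^+ 2) ^+ 2 ->
  eps^-1 - zeta <= adam_sigma beta eps k.+1 v j.
Proof.
have /andP[b0 b1] := beta01.
move=> z0 vj; rewrite /adam_sigma; set s := Num.sqrt _.
have s0 : 0 <= s := sqrtr_ge0 _.
have bk : 1 - beta <= 1 - beta ^+ k.+1.
  by rewrite lerD2l lerN2 exprS ler_piMr// exprn_ile1// ltW.
have c0 : 0 < 1 - beta by rewrite subr_gt0.
have sz : s <= zeta * eps ^+ 2.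
  have z2 : 0 <= zeta * eps ^+ 2 by rewrite mulr_ge0// sqr_ge0.
  rewrite -[leRHS]ger0_norm// -sqrtr_sqr ler_wsqrtr//.
  rewrite ler_pdivrMr; last exact: lt_le_trans bk.
  by apply: (le_trans vj); rewrite mulrC ler_wpM2l// sqr_ge0.
have se : 0 < s + eps by rewrite ltr_wpDl.
rewrite [leRHS](_ : _ = eps^-1 - s / (eps * (s + eps))); last first.
  by field; rewrite ?gt_eqF.
rewrite lerD2l lerN2 ler_pdivrMr ?mulr_gt0//.
apply: (le_trans sz); have := mulr_ge0 z0 (mulr_ge0 s0 (ltW eps0)).
by rewrite expr2; lra.
Qed.

End adam_preconditioner.

(** * Adam near the set of minima *)
Section adam_near_minima.
Context (R : realType) (d : nat) (T : finType).
(** X t is the estimator for the outcome t and f the objective.  The set O is the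
    neighbourhood of the minima in which the Lojasiewicz inequality is used, and N
    a larger one that contains all the points within delta of O; in K, a point of N where
    f < r1 is in O. *)
Variables (X : T -> 'rV[R]_d -> 'rV[R]_d) (f : 'rV[R]_d -> R).
Variables (gamma s : nat -> R) (alpha beta eps : R).
Variables (K O N : set 'rV[R]_d) (B BX L mu delta r1 : R).

Hypothesis T_gt0 : (0 < #|T|)%N.
Hypothesis gamma_gt0 : forall k, 0 < gamma k.
Hypothesis gamma_dec : nonincreasing_seq gamma.
Hypothesis alpha01 : 0 <= alpha < 1.
Hypothesis beta01 : 0 <= beta < 1.
Hypothesis eps_gt0 : 0 < eps.
Hypothesis s_spec : forall k,
  0 <= s k <= gamma k / (1 - alpha) /\ s k = gamma k + alpha * s k.+1.
Hypothesis f_ge0 : forall x, 0 <= f x.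
Hypothesis B_gt0 : 0 < B.
Hypothesis X_le_f : forall x t, K x -> sqn (X t x) <= B * f x.
Hypothesis BX_ge0 : 0 <= BX.
Hypothesis X_le : forall x t, K x -> sqn (X t x) <= BX.
Hypothesis X_mean : forall x, \sum_t X t x = - (#|T|%:R *: grad f x).
Hypothesis L_gt0 : 0 < L.
Hypothesis f_smooth : forall x y, K x -> K y ->
  f y <= f x + dot (grad f x) (y - x) + L * sqn (y - x).
Hypothesis grad_lip : forall x y, K x -> K y ->
  sqn (grad f y - grad f x) <= L ^+ 2 * sqn (y - x).
Hypothesis mu_gt0 : 0 < mu.
Hypothesis PL : forall x, O x -> 2 * mu * f x <= sqn (grad f x).
Hypothesis delta_gt0 : 0 < delta.
Hypothesis O_N : forall x y, O x -> `|y - x| <= delta -> N y.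
Hypothesis r1_gt0 : 0 < r1.
Hypothesis N_O : forall x, K x -> N x -> f x < r1 -> O x.

(** One step of Adam on the triple (theta, m, v), the step number k starting
    from 0. *)
Definition adam_next (k : nat) (t : T) (st : 'rV[R]_d * 'rV[R]_d * 'rV[R]_d) :=
  let x := X t st.1.1 in
  let m' := alpha *: st.1.2 + (1 - alpha) *: x in
  let v' := \row_j (beta * st.2 0 j + (1 - beta) * x 0 j ^+ 2) in
  (\row_j (st.1.1 0 j + gamma k * adam_sigma beta eps k.+1 v' j * m' 0 j),
   m', v').

(** e is the limit of the preconditioner, b the coefficient of the squared
    momentum, zeta the tolerated error on the preconditioner, eta the bound on v
    that guarantees it, lev the level of the Lyapunov function below which the
    iterate is trapped, a the coefficient of the cross term, A * gamma its bound,
    B1 an eventual bound on the moments, and c the contraction rate. *)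
Let e := eps^-1.
Let b := e * mu / (4 * B).
Let zeta := Num.min ((1 - alpha) * e) (b * (1 - alpha) / 2).
Let eta := (1 - beta) * (zeta * eps ^+ 2) ^+ 2.
Let lev := Num.min r1 (eta / B) / 2.
Let a k := alpha * e * s k.
Let A := alpha * e / (1 - alpha).
Let B1 := BX + 1.
Let c := Num.min ((1 - alpha) * e * mu / 4) ((1 - alpha) / 4).

(** Step-sizes that are small enough for all the estimates below; as
    gamma tends to 0, they are so from some step on. *)
Definition small_step (k : nat) : Prop :=
  [/\ gamma k <= 1, gamma k * ((e + A) ^+ 2 * B) <= b,
      gamma k * (L * e ^+ 2 + A * L * e) <= b * (1 - alpha) / 4 &
      gamma k * (e * (B1 + 1)) <= delta].

(** The Lyapunov function of Adam at step k. *)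
Definition lyapunov (k : nat) (st : 'rV[R]_d * 'rV[R]_d * 'rV[R]_d) : R :=
  f st.1.1 + a k * dot (grad f st.1.1) st.1.2 + b * gamma k * sqn st.1.2.

(** theta is in K, and the moments m and v are bounded as they eventually are along
    every trajectory that stays in K. *)
Definition tame (st : 'rV[R]_d * 'rV[R]_d * 'rV[R]_d) : Prop :=
  [/\ K st.1.1, sqn st.1.2 <= B1 & forall j, st.2 0 j <= B1].

(** theta is near the minima with small risk, small v and small Lyapunov
    function. *)
Definition trapped (k : nat) (st : 'rV[R]_d * 'rV[R]_d * 'rV[R]_d) : Prop :=
  [/\ O st.1.1, f st.1.1 < 2 * lev, forall j, st.2 0 j <= eta &
      lyapunov k st < lev].

(** The Lyapunov function relative to lev on trapped states, and 1 elsewhere: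
    the supermartingale of the proof. *)
Definition trap_level (k : nat) (st : 'rV[R]_d * 'rV[R]_d * 'rV[R]_d) : R :=
  if `[< trapped k st >] then lyapunov k st / lev else 1.

Let alpha1 : 0 < 1 - alpha.
Proof. by case/andP: alpha01 => _; rewrite subr_gt0. Qed.
Let alpha0 : 0 <= alpha. Proof. by case/andP: alpha01. Qed.
Let beta0 : 0 <= beta. Proof. by case/andP: beta01. Qed.
Let beta1 : 0 < 1 - beta.
Proof. by case/andP: beta01 => _; rewrite subr_gt0. Qed.
Let e_gt0 : 0 < e. Proof. by rewrite invr_gt0. Qed.
Let b_gt0 : 0 < b. Proof. by rewrite divr_gt0 ?mulr_gt0. Qed.
Let zeta_gt0 : 0 < zeta.
Proof.
rewrite lt_min (mulr_gt0 alpha1 e_gt0)/=.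
by rewrite mulr_gt0// ?invr_gt0// mulr_gt0.
Qed.
Let eta_gt0 : 0 < eta.
Proof. by rewrite mulr_gt0// !exprn_gt0// !mulr_gt0// exprn_gt0. Qed.
Let lev_gt0 : 0 < lev. Proof. by rewrite divr_gt0// lt_min r1_gt0 divr_gt0. Qed.
Let lev_r1 : 2 * lev <= r1.
Proof. by rewrite mulrC divfK// ge_min lexx. Qed.
Let lev_eta : B * (2 * lev) <= eta.
Proof. by rewrite [2 * _]mulrC divfK// mulrC -ler_pdivlMr// ge_min lexx orbT. Qed.
Let A_ge0 : 0 <= A. Proof. by rewrite !mulr_ge0 ?invr_ge0// ltW. Qed.
Let B1_gt0 : 0 < B1. Proof. by rewrite ltr_wpDl. Qed.

Let a_bound k : 0 <= a k <= A * gamma k.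
Proof.
have [/andP[s0 sle] _] := s_spec k.
have ae0 : 0 <= alpha * e by rewrite mulr_ge0// ltW.
rewrite mulr_ge0//= (le_trans (ler_wpM2l ae0 sle))//.
by rewrite /A le_eqVlt; apply/orP; left; apply/eqP; field; rewrite gt_eqF.
Qed.

Let a_rec k : a k = alpha * (gamma k * e + a k.+1).
Proof. by have [_] := s_spec k; rewrite /a => {1}->; ring. Qed.

Let grad_le x : K x -> sqn (grad f x) <= B * f x.
Proof.
move=> Kx; have T0 : (0 : R) < #|T|%:R by rewrite ltr0n.
have := sqn_sum (fun t => X t x); rewrite X_mean sqnN sqnZ expr2 -mulrA ler_pM2l//.
have : \sum_t sqn (X t x) <= \sum_(t : T) B * f x.
  by apply: ler_sum => t _; exact: X_le_f.
rewrite sumr_const -[leRHS]mulr_natl => h1 h2; have := le_trans h2 h1.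
by rewrite ler_pM2l.
Qed.

Let cross_le k q x m : small_step k -> K x -> 0 <= q -> q <= (e + A) * gamma k ->
  `|q * dot (grad f x) m| <= (f x + b * gamma k * sqn m) / 2.
Proof.
move=> [_ h _ _] Kx q0 qle.
have s0 : 0 < b * gamma k by rewrite mulr_gt0.
have bnd : (q ^+ 2 * sqn (grad f x)) / (b * gamma k) <= f x.
  rewrite ler_pdivrMr//.
  apply: (@le_trans _ _ (((e + A) * gamma k) ^+ 2 * (B * f x))).
    rewrite ler_pM ?sqr_ge0 ?sqn_ge0 ?grad_le// ler_sqr// nnegrE.
    exact: le_trans qle.
  have := ler_wpM2l (mulr_ge0 (f_ge0 x) (ltW (gamma_gt0 k))) h.
  by lra.
have := dot_young (q *: grad f x) m s0.
have := dot_young (- (q *: grad f x)) m s0.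
rewrite sqnN dotNl dotZl sqnZ => h1 h2.
by rewrite ler_norml; apply/andP; split; lra.
Qed.

Let a_le k : a k <= (e + A) * gamma k.
Proof.
have /andP[_ h] := a_bound k; apply: (le_trans h).
by rewrite ler_wpM2r ?(ltW (gamma_gt0 k))// lerDr ltW.
Qed.

(** Value of the objective below which a point of O starts an excursion. *)
Definition entry_level : R := Num.min (lev / 12) (eta / (4 * B)).

Lemma entry_level_gt0 : 0 < entry_level.
Proof. by rewrite lt_min divr_gt0//= divr_gt0// mulr_gt0. Qed.

Lemma lyapunov_bounds k th m v : small_step k -> K th ->
  (f th + b * gamma k * sqn m) / 2 <= lyapunov k (th, m, v) <=
  3 / 2 * (f th + b * gamma k * sqn m).
Proof.
move=> sk Kth; have /andP[a0 _] := a_bound k.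
have := cross_le m sk Kth a0 (a_le k).
rewrite ler_norml /lyapunov/= => /andP[h1 h2]; apply/andP; split; lra.
Qed.

Lemma tame_lyapunov_ge k st : small_step k -> tame st -> f st.1.1 / 2 <= lyapunov k st.
Proof.
move=> sk; case: st => [[th m] v] [/= Kth _ _].
have /andP[h _] := lyapunov_bounds m v sk Kth; apply: le_trans h.
by rewrite ler_pM2r// lerDl mulr_ge0 ?sqn_ge0// mulr_ge0// ltW.
Qed.

Lemma trap_level_ge0 k st : small_step k -> tame st -> 0 <= trap_level k st.
Proof.
move=> sk tst; rewrite /trap_level; case: ifP => // _.
apply: divr_ge0; last exact: ltW.
by apply: le_trans (tame_lyapunov_ge sk tst); rewrite divr_ge0.
Qed.

Lemma trap_level_lt1 k st : trap_level k st < 1 -> trapped k st.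
Proof.
by rewrite /trap_level; case: (asboolP (trapped k st)) => // _; rewrite ltxx.
Qed.

Lemma adam_next_step k t st j :
  ((adam_next k t st).1.1 - st.1.1) 0 j =
  gamma k * adam_sigma beta eps k.+1 (adam_next k t st).2 j *
    (adam_next k t st).1.2 0 j.
Proof. by rewrite !mxE addrAC subrr add0r. Qed.

Lemma adam_next_sqn k t st :
  sqn ((adam_next k t st).1.1 - st.1.1) <=
  (gamma k * e) ^+ 2 * sqn (adam_next k t st).1.2.
Proof.
rewrite [sqn (adam_next _ _ _).1.2]sqnE sqnE mulr_sumr; apply: ler_sum => j _.
rewrite adam_next_step.
set sg := adam_sigma _ _ _ _ _; set y := (adam_next k t st).1.2 0 j.
have /andP[s0 s1] : 0 <= sg <= e by exact: adam_sigma_bounds.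
rewrite !exprMn ler_wpM2r ?sqr_ge0// ler_wpM2l ?sqr_ge0//.
by rewrite ler_sqr ?nnegrE// ltW.
Qed.

Lemma adam_next_small k t st : sqn (adam_next k t st).1.2 <= B1 ->
  `|(adam_next k t st).1.1 - st.1.1| <= gamma k * (e * (B1 + 1)).
Proof.
move=> qB; have h0 : 0 <= gamma k * (e * (B1 + 1)).
  by rewrite !mulr_ge0 ?addr_ge0// ltW.
rewrite -ler_sqr ?nnegrE//.
apply: (le_trans (mx_norm_le_sqn _)); apply: (le_trans (adam_next_sqn _ _ _)).
rewrite mulrA [leRHS]exprMn ler_wpM2l ?sqr_ge0//.
by apply: (le_trans qB); have := sqr_ge0 B1; have := B1_gt0; lra.
Qed.

(** A tame step out of a trapped state ends in a trapped state unless the Lyapunov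
    function reaches lev, so trap_level is at most Psi / lev in both cases. *)
Lemma adam_next_trapped k t st : small_step k -> small_step k.+1 ->
  tame st -> tame (adam_next k t st) -> trapped k st ->
  trap_level k.+1 (adam_next k t st) <= lyapunov k.+1 (adam_next k t st) / lev.
Proof.
move=> sk sk1 tst tst' [Oth fth veta _].
rewrite /trap_level; case: asboolP => // nt.
rewrite ler_pdivlMr// mul1r leNgt; apply/negP => lt; apply: nt.
have [Kth' qB _] := tst'.
have f'lt : f (adam_next k t st).1.1 < 2 * lev.
  by have := tame_lyapunov_ge sk1 tst'; lra.
have [_ _ _ gd] := sk.
split => //.
  apply: N_O => //; last exact: lt_le_trans lev_r1.
  apply: (O_N Oth); apply: (le_trans (adam_next_small qB)).
  exact: gd.
move=> j; rewrite mxE.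
have [Kth _ _] := tst.
have x2 : X t st.1.1 0 j ^+ 2 <= eta.
  apply: (le_trans (sqr_coord_le _ _)); apply: (le_trans (X_le_f _ Kth)).
  by apply: le_trans lev_eta; rewrite ler_wpM2l// ltW.
have := ler_wpM2l beta0 (veta j); have := ler_wpM2l (ltW beta1) x2.
by lra.
Qed.

Lemma trap_level_drift k st : small_step k -> small_step k.+1 -> tame st ->
  trap_level k st < 1 ->
  \sum_t (if `[< tame (adam_next k t st) >]
          then trap_level k.+1 (adam_next k t st) else 0) <=
  #|T|%:R * ((1 - c * gamma k) * trap_level k st).
Proof.
move=> sk sk1 tst /trap_level_lt1 tr.
have -> : trap_level k st = lyapunov k st / lev.
  by rewrite /trap_level; case: asboolP.
have [Oth fth veta _] := tr; have [Kth qB _] := tst.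
set psi' := fun t => if `[< tame (adam_next k t st) >]
  then lyapunov k.+1 (adam_next k t st) else 0.
apply: (@le_trans _ _ (\sum_t psi' t / lev)).
  apply: ler_sum => t _; rewrite /psi'; case: asboolP => tst'; last by rewrite mul0r.
  exact: adam_next_trapped.
rewrite -mulr_suml !mulrA ler_pM2r ?invr_gt0// -mulrA.
have /andP[a0 aA] := a_bound k; have /andP[a'0 a'A] := a_bound k.+1.
have g1 := gamma_dec (leqnSn k).
have a'A' : a k.+1 <= A * gamma k by apply: (le_trans a'A); rewrite ler_wpM2l.
have [gle1 gA gk gd] := sk.
set kap := zeta / 2 + L * (gamma k * e ^+ 2) + a k.+1 * (L * e).
(* kap collects the errors that are of higher order in zeta and gamma. *)
have kapb : kap <= b * (1 - alpha) / 2.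
  have z2 : zeta <= b * (1 - alpha) / 2 by rewrite ge_min lexx orbT.
  have := ler_wpM2r (mulr_ge0 (ltW L_gt0) (ltW e_gt0)) a'A'.
  by move: gk; rewrite /kap; lra.
have psi'le t : psi' t <= f st.1.1
    + (gamma k * e + a k.+1) * dot (grad f st.1.1) (adam_next k t st).1.2
    + gamma k * zeta / 2 * sqn (grad f st.1.1)
    + gamma k * (b + kap) * sqn (adam_next k t st).1.2.
  rewrite /psi'; case: asboolP => tst'.
    have [Kth' _ _] := tst'.
    apply: (lyapunov_pointwise (D := (adam_next k t st).1.1 - st.1.1)
      (sigma := adam_sigma beta eps k.+1 (adam_next k t st).2)) => //.
    - exact: ltW.
    - exact: ltW.
    - exact: adam_next_step.
    - by move=> j; exact: adam_sigma_bounds.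
    - move=> j; apply: adam_sigma_ge => //; first exact: ltW.
      rewrite mxE.
      have x2 : X t st.1.1 0 j ^+ 2 <= eta.
        apply: (le_trans (sqr_coord_le _ _)); apply: (le_trans (X_le_f _ Kth)).
        by apply: le_trans lev_eta; rewrite ler_wpM2l// ltW.
      have := ler_wpM2l beta0 (veta j); have := ler_wpM2l (ltW beta1) x2.
      by rewrite -/eta; lra.
    - exact: f_smooth.
    - exact: grad_lip.
  (* For a state that is not tame psi' is 0, and the bound is nonnegative. *)
  have q0 : 0 <= gamma k * e + a k.+1.
    by rewrite addr_ge0// mulr_ge0// ltW.
  have qle : gamma k * e + a k.+1 <= (e + A) * gamma k by lra.
  have := cross_le (adam_next k t st).1.2 sk Kth q0 qle.
  rewrite ler_norml => /andP[h _].
  have h1 : 0 <= gamma k * zeta / 2 * sqn (grad f st.1.1).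
    by rewrite mulr_ge0 ?sqn_ge0// divr_ge0// mulr_ge0// ltW.
  have kap0 : 0 <= kap.
    rewrite /kap !addr_ge0//; first by rewrite divr_ge0// ltW.
      by rewrite mulr_ge0 ?(ltW L_gt0)// mulr_ge0 ?sqr_ge0// ltW.
    by rewrite mulr_ge0// mulr_ge0// ltW.
  have h2 : 0 <= gamma k * kap * sqn (adam_next k t st).1.2.
    by rewrite mulr_ge0 ?sqn_ge0// mulr_ge0// ltW.
  have h3 : 0 <= gamma k * b * sqn (adam_next k t st).1.2.
    by rewrite mulr_ge0 ?sqn_ge0// mulr_ge0// ltW.
  have := f_ge0 st.1.1; lra.
have C1 : b * B = e * mu / 4 by rewrite /b; field; rewrite gt_eqF.
apply: (@lyapunov_drift _ _ T (f st.1.1) (gamma k) e zeta L (a k) (a k.+1) b c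
  alpha B mu (grad f st.1.1) st.1.2 (fun t => X t st.1.1)
  (fun t => (adam_next k t st).1.2) psi') => //.
- by rewrite gamma_gt0.
- exact: ltW.
- exact: ltW.
- exact: ltW.
- exact: ltW.
- by move=> t; exact: X_le_f.
- exact: PL.
- by rewrite ge_min lexx.
- by rewrite mulrCA C1; lra.
- have h : kap <= b.
    apply: (le_trans kapb); rewrite -mulrA ler_piMr ?(ltW b_gt0)//.
    by have := alpha0; lra.
  have := ler_wpM2r (mulr_ge0 (ltW alpha1) (ltW B_gt0)) h.
  by rewrite -/kap [b * _]mulrCA C1 => /le_trans; apply; lra.
- have /andP[_ al1] := alpha01.
  apply: le_trans kapb; rewrite -/kap ler_piMr ?(ltW al1)//.
  rewrite /kap !addr_ge0//; first by rewrite divr_ge0// ltW.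
    by rewrite mulr_ge0 ?(ltW L_gt0)// mulr_ge0 ?sqr_ge0// ltW.
  by rewrite mulr_ge0// mulr_ge0// ltW.
- exact: (cross_le st.1.2 sk Kth a0 (a_le k)).
- by rewrite le_min !divr_ge0// ?mulr_ge0// ltW.
- by rewrite ge_min lexx.
- by rewrite ge_min lexx orbT.
Qed.


Section trajectory.
Variables (st : nat -> 'rV[R]_d * 'rV[R]_d * 'rV[R]_d) (u : nat -> T).
Hypothesis st_next : forall k, st k.+1 = adam_next k (u k) (st k).
Hypothesis gamma_to0 : gamma @ \oo --> 0.

Let gamma_eventually (q r : R) : 0 < r ->
  exists n, forall k, (n <= k)%N -> gamma k * q <= r.
Proof.
move=> r0; have r0' : 0 < r / (`|q| + 1) by rewrite divr_gt0// ltr_wpDl.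
have /cvgrPdist_le/(_ _ r0')[n _ Hn] := gamma_to0.
exists n => k /Hn /=; rewrite sub0r normrN ger0_norm ?(ltW (gamma_gt0 k))//.
rewrite ler_pdivlMr ?ltr_wpDl// => h.
have := ler_wpM2l (ltW (gamma_gt0 k)) (ler_norm q).
have := gamma_gt0 k; lra.
Qed.

Lemma small_step_eventually : exists n, forall k, (n <= k)%N -> small_step k.
Proof.
have [n1 h1] := gamma_eventually 1 ltr01.
have [n2 h2] := gamma_eventually ((e + A) ^+ 2 * B) b_gt0.
have b4 : 0 < b * (1 - alpha) / 4 by rewrite divr_gt0// mulr_gt0.
have [n3 h3] := gamma_eventually (L * e ^+ 2 + A * L * e) b4.
have [n4 h4] := gamma_eventually (e * (B1 + 1)) delta_gt0.
exists (maxn (maxn n1 n2) (maxn n3 n4)) => k.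
rewrite !geq_max => /andP[/andP[k1 k2] /andP[k3 k4]].
by split; [have := h1 k k1; rewrite mulr1|exact: h2|exact: h3|exact: h4].
Qed.

Lemma tame_eventually n0 : (forall k, (n0 <= k)%N -> K (st k).1.1) ->
  exists n, forall k, (n <= k)%N -> tame (st k).
Proof.
move=> Kst.
have [n1 h1] : exists n1, forall n, (n1 <= n)%N -> sqn (st n).1.2 <= BX + 1.
  apply: (@contraction_eventually _ _ alpha BX 1 n0) => // k nk.
  rewrite st_next /=; apply: (le_trans (sqn_convex _ _ _)).
    by rewrite alpha0 -subr_ge0 ltW.
  by rewrite lerD2l ler_wpM2l// ?(ltW alpha1)// X_le//; exact: Kst.
have /choice[n2 h2] (j : 'I_d) : exists n2, forall n, (n2 <= n)%N ->
    (st n).2 0 j <= BX + 1.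
  apply: (@contraction_eventually _ (fun n => (st n).2 0 j) beta BX 1 n0) => // k nk.
  rewrite st_next /= mxE lerD2l ler_wpM2l ?(ltW beta1)//.
  apply: (le_trans (sqr_coord_le _ _)); exact/X_le/Kst.
exists (maxn n0 (maxn n1 (\max_j n2 j))) => k.
rewrite !geq_max => /andP[k0 /andP[k1 k2]]; split; [exact: Kst|exact: h1|].
move=> j; apply: h2; apply: leq_trans k2; exact: leq_bigmax.
Qed.

Variable n0 : nat.
Hypothesis st_tame : forall k, (n0 <= k)%N -> tame (st k).

Let displacement n i : (n0 <= n)%N ->
  `|(st (n + i)%N).1.1 - (st n).1.1| <= i%:R * (gamma n * (e * (B1 + 1))).
Proof.
move=> nn; elim: i => [|i IH]; first by rewrite addn0 subrr normr0 mul0r.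
rewrite addnS -[X in `|X|](subrKA (st (n + i)%N).1.1).
apply: (le_trans (ler_normD _ _)).
rewrite -natr1 mulrDl mul1r addrC lerD//.
have [_ qB _] : tame (st (n + i).+1).
  by apply: st_tame; rewrite ltnW// ltnS (leq_trans nn)// leq_addr.
rewrite st_next in qB *; apply: (le_trans (adam_next_small qB)).
rewrite ler_wpM2r//; first by rewrite mulr_ge0 ?addr_ge0// ltW.
by apply: gamma_dec; exact: leq_addr.
Qed.

Hypothesis f_uc : forall r : R, 0 < r -> exists2 rho : R, 0 < rho &
  forall x y, K x -> `|x - y| <= rho -> f y <= f x + r.

(** From a point of O where f is below entry_level, J further steps suffice, where
    beta^J makes v small: during these J steps theta moves by O(gamma) and f
    increases at most to 2 * entry_level, and at the end the momentum part of the
    Lyapunov function is O(gamma). *)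
Lemma trap_entered :
  (forall n, exists2 k, (n <= k)%N &
     O (st k).1.1 /\ f (st k).1.1 < entry_level) ->
  forall n, exists2 k, (n <= k)%N & trap_level k (st k) <= 2^-1.
Proof.
move=> io M; set r0 := entry_level in io; have r00 : 0 < r0 := entry_level_gt0.
have r0l : r0 <= lev / 12 by rewrite ge_min lexx.
have r0e : B * (2 * r0) <= eta / 2.
  have : r0 <= eta / (4 * B) by rewrite ge_min lexx orbT.
  by rewrite ler_pdivlMr ?mulr_gt0//; lra.
have [rho rho0 Hrho] := f_uc r00.
have [J HJ] : exists J, beta ^+ J * B1 <= eta / 2.
  have eta2 : 0 < eta / 2 by rewrite divr_gt0.
  have : (fun k => B1 * beta ^+ k) @ \oo --> 0.
    have := @cvg_geometric _ B1 beta; rewrite ger0_norm//; apply.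
    by rewrite -subr_gt0.
  move=> /cvgrPdist_le/(_ _ eta2)[J _ HJ]; exists J.
  have := HJ J (leqnn J); rewrite /= sub0r normrN mulrC.
  exact/le_trans/ler_norm.
have [n1 h1] := small_step_eventually.
have [n2 h2] := gamma_eventually (J%:R * (e * (B1 + 1))) rho0.
have [n3 h3] := gamma_eventually (J%:R * (e * (B1 + 1))) delta_gt0.
have lev6 : 0 < lev / 6 by rewrite divr_gt0.
have [n4 h4] := gamma_eventually (b * B1) lev6.
have [n Mn [On fn]] := io (maxn M (maxn n0 (maxn (maxn n1 n2) (maxn n3 n4)))).
move: Mn; rewrite !geq_max => /and3P[Mn nn0 /andP[/andP[nn1 nn2] /andP[nn3 nn4]]].
have nJ i : (n <= n + i)%N := leq_addr i n.
have disp i : (i <= J)%N -> `|(st (n + i)%N).1.1 - (st n).1.1| <=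
    gamma n * (J%:R * (e * (B1 + 1))).
  move=> iJ; apply: (le_trans (displacement i nn0)).
  rewrite mulrCA ler_wpM2l ?(ltW (gamma_gt0 n))// ler_wpM2r ?ler_nat//.
  by rewrite mulr_ge0 ?addr_ge0// ltW.
have [Kn _ vn] := st_tame nn0.
have fi i : (i <= J)%N -> f (st (n + i)%N).1.1 < 2 * r0.
  move=> iJ; apply: (le_lt_trans (Hrho _ _ Kn _)); last by lra.
  by rewrite distrC (le_trans (disp i iJ))// h2.
have [Km qm _] := st_tame (leq_trans nn0 (nJ J)).
have OJ : O (st (n + J)%N).1.1.
  apply: N_O => //; last by have := fi J (leqnn J); have := lev_r1; lra.
  by apply: (O_N On); rewrite (le_trans (disp J (leqnn J)))// h3.
have vJ j : (st (n + J)%N).2 0 j <= eta.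
  have := @contraction_iter _ (fun k => (st k).2 0 j) beta (B * (2 * r0)) n J.
  rewrite beta0 -subr_ge0 (ltW beta1) => /(_ isT) h.
  have {}h : (st (n + J)%N).2 0 j - B * (2 * r0) <=
      beta ^+ J * ((st n).2 0 j - B * (2 * r0)).
    apply: h => i iJ; rewrite addnS st_next /= mxE lerD2l ler_wpM2l ?(ltW beta1)//.
    apply: (le_trans (sqr_coord_le _ _)).
    have [Ki _ _] := st_tame (leq_trans nn0 (nJ i)).
    apply: (le_trans (X_le_f _ Ki)); rewrite ler_wpM2l ?(ltW B_gt0)//.
    by rewrite ltW// fi// ltnW.
  have h5 : beta ^+ J * ((st n).2 0 j - B * (2 * r0)) <= beta ^+ J * B1.
    rewrite ler_wpM2l ?exprn_ge0//; apply: le_trans (vn j).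
    by rewrite gerBl !mulr_ge0// ltW.
  by lra.
have sJ : small_step (n + J)%N by apply: h1; apply: leq_trans nn1 (nJ J).
exists (n + J)%N; first exact: leq_trans Mn (nJ J).
have lyap : lyapunov (n + J)%N (st (n + J)%N) <= lev / 2.
  case E : (st (n + J)%N) Km qm => [[th m] v] /= Kth qm.
  have /andP[_ hl] := lyapunov_bounds m v sJ Kth.
  apply: (le_trans hl).
  have h5 : b * gamma (n + J)%N * sqn m <= b * gamma (n + J)%N * B1.
    by rewrite ler_wpM2l// mulr_ge0// ltW.
  have h6 := h4 _ (leq_trans nn4 (nJ J)).
  have := fi J (leqnn J); rewrite E /=; lra.
rewrite /trap_level asboolT.
  by rewrite ler_pdivrMr// mulrC.
split => //; last by have := lev_gt0; lra.
by have := fi J (leqnn J); have := lev_gt0; lra.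
Qed.

Lemma trap_level_cvg0 : (fun k => trap_level k (st k)) @ \oo --> 0 ->
  forall r : R, 0 < r -> exists n, forall k, (n <= k)%N ->
    K (st k).1.1 /\ O (st k).1.1 /\ f (st k).1.1 < r.
Proof.
move=> cv r r0; have [n1 h1] := small_step_eventually.
pose q := Num.min 2^-1 (r / (4 * lev)).
have q0 : 0 < q by rewrite lt_min invr_gt0 ltr0n/= divr_gt0// mulr_gt0.
move: cv => /cvgrPdist_le/(_ _ q0)[n _ Hn].
exists (maxn n (maxn n0 n1)) => k; rewrite !geq_max => /and3P[nk nk0 nk1].
have := Hn k nk; rewrite /= sub0r normrN => /(le_trans (ler_norm _)).
rewrite le_min => /andP[t1 t2].
have /trap_level_lt1 tr : trap_level k (st k) < 1 by apply: (le_lt_trans t1); lra.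
have [Kk _ _] := st_tame nk0; split => //; have [Ok _ _ _] := tr; split => //.
move: t2; rewrite /trap_level asboolT//.
rewrite ler_pdivrMr// (_ : r / (4 * lev) * lev = r / 4); last first.
  by field; rewrite gt_eqF.
have := tame_lyapunov_ge (h1 k nk1) (st_tame nk0); lra.
Qed.

End trajectory.

Section almost_sure_convergence.
Context (dO : measure_display) (Omega : measurableType dO).
Variables (P : probability Omega R) (Us : nat -> Omega -> T).
Hypothesis cylinder_measurable : forall h, measurable (cylinder Us h).
Hypothesis cylinder_prob :
  forall h, P (cylinder Us h) = ((#|T|%:R ^- size h)%:E : \bar R).
Hypothesis gamma_to0 : gamma @ \oo --> 0.
Hypothesis gamma_div : forall q : R, exists n, q <= \sum_(i < n) gamma i.
Hypothesis f_uc : forall r : R, 0 < r -> exists2 rho : R, 0 < rho &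
  forall x y, K x -> `|x - y| <= rho -> f y <= f x + r.
Variable st0 : 'rV[R]_d * 'rV[R]_d * 'rV[R]_d.

(** The state of Adam after the draws of h, the latest one first. *)
Fixpoint adam_state (h : seq T) : 'rV[R]_d * 'rV[R]_d * 'rV[R]_d :=
  if h is t :: h' then adam_next (size h') t (adam_state h') else st0.

(** Almost surely, a trajectory that stays in K eventually and visits the part of O
    where f is below entry_level infinitely often stays in O, and f tends to 0
    along it. *)
Lemma adam_converges_in_trap : {ae P, forall w,
  let st k := adam_state (history Us k w) in
  (exists n0, forall k, (n0 <= k)%N -> K (st k).1.1) ->
  (forall n, exists2 k, (n <= k)%N &
     O (st k).1.1 /\ f (st k).1.1 < entry_level) ->
  forall r : R, 0 < r -> exists n, forall k, (n <= k)%N ->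
    K (st k).1.1 /\ O (st k).1.1 /\ f (st k).1.1 < r}.
Proof.
have [n1 h1] := small_step_eventually gamma_to0.
have c0 : 0 < c by rewrite lt_min !divr_gt0// !mulr_gt0.
(* The rate is only used for small steps; it is 0 before, to be always below 1. *)
pose rate n := if (n < n1)%N then 0 else c * gamma n.
have rate01 n : 0 <= rate n < 1.
  rewrite /rate; case: ltnP => [_|nn]; first by rewrite lexx ltr01.
  rewrite mulr_ge0 ?(ltW c0) ?(ltW (gamma_gt0 n))//=.
  have [g1 _ _ _] := h1 n nn.
  have c4 : c <= (1 - alpha) / 4 by rewrite ge_min lexx orbT.
  have h := ler_wpM2l (ltW c0) g1; apply: (le_lt_trans h).
  by have := alpha0; lra.
have rate_div q : exists n, q <= \sum_(i < n) rate i.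
  have [n Hn] := gamma_div (q / c + \sum_(i < n1) gamma i).
  exists (n1 + n)%N; rewrite big_split_ord/= big1 ?add0r; last first.
    by move=> i _; rewrite /rate/= ltn_ord.
  have -> : \sum_(i < n) rate (n1 + i)%N = c * \sum_(i < n) gamma (n1 + i)%N.
    by rewrite mulr_sumr; apply: eq_bigr => i _; rewrite /rate ltnNge leq_addr.
  rewrite -ler_pdivrMl// mulrC -(lerD2r (\sum_(i < n1) gamma i)).
  apply: (le_trans Hn).
  have -> : \sum_(i < n) gamma (n1 + i)%N + \sum_(i < n1) gamma i =
      \sum_(i < n1 + n) gamma i by rewrite big_split_ord/= addrC.
  rewrite addnC big_split_ord/= lerDl.
  by apply: sumr_ge0 => i _; exact/ltW.
have dich m : {ae P, forall w,
    (forall n, (maxn n1 m < n)%N -> `[< tame (adam_state (history Us n w)) >]) ->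
    (forall N, exists2 n, (N <= n)%N &
       trap_level n (adam_state (history Us n w)) <= 2^-1) ->
    (fun n => trap_level n (adam_state (history Us n w))) @ \oo --> 0}.
  have := @supermartingale_dichotomy _ _ _ P T Us cylinder_measurable
    cylinder_prob T_gt0 (fun h => trap_level (size h) (adam_state h))
    (fun h => `[< tame (adam_state h) >]) rate (maxn n1 m) rate01 rate_div.
  move=> H; have {H} : {ae P, forall w,
    (forall n, (maxn n1 m < n)%N -> `[< tame (adam_state (history Us n w)) >]) ->
    (forall N, exists2 n, (N <= n)%N &
       trap_level (size (history Us n w)) (adam_state (history Us n w)) <= 2^-1) ->
    (fun n => trap_level (size (history Us n w)) (adam_state (history Us n w)))
      @ \oo --> 0}.
    apply: H => h; rewrite gtn_max => /andP[nh _] /asboolP th.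
      exact/trap_level_ge0/th/h1/ltnW.
    have s1 : small_step (size h) by exact/h1/ltnW.
    have s2 : small_step (size h).+1 by exact/h1/ltnW/ltnW.
    rewrite /rate ltnNge ltnW//= => y1; exact: trap_level_drift.
  apply: filterS => w H tw io.
  rewrite (_ : (fun n => _) = fun n => trap_level (size (history Us n w))
    (adam_state (history Us n w))); last first.
    by apply/funext => n; rewrite size_history.
  apply: H => // N1; have [n Nn tn] := io N1.
  by exists n => //; rewrite size_history.
have := ae_foralln dich; apply: filterS => w H st [n0 Kst] io r r0.
have stS k : st k.+1 = adam_next k (Us k w) (st k) by rewrite /st/= size_history.
have [m tm] := tame_eventually stS Kst.
have := trap_entered stS gamma_to0 tm f_uc io => te.
apply: (trap_level_cvg0 gamma_to0 tm) r0.
apply: (H m) => // n; rewrite gtn_max => /andP[_ mn].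
by apply/asboolP/tm/ltnW.
Qed.

End almost_sure_convergence.
End adam_near_minima.

(** * Bounds on compact sets and the distance to a set *)
Section assembly.
Context (R : realType) (d : nat).

Lemma compact_enorm_bounded (K : set 'rV[R]_d) : compact K ->
  exists2 rho : R, 0 < rho & forall x, K x -> enorm x <= rho.
Proof.
move=> /compact_bounded[r [_ Hr]].
pose q := `|r| + 1; have rq : r < q.
  by apply: le_lt_trans (ler_norm r) _; rewrite ltrDl.
exists ((d%:R + 1) * q) => [|x Kx].
  by rewrite mulr_gt0 ?ltr_wpDl// (le_lt_trans _ rq).
have q0 : 0 <= q by rewrite addr_ge0.
have d0 : (0 : R) <= d%:R by [].
rewrite enorm_le ?mulr_ge0 ?addr_ge0//.
apply: (le_trans (sqn_le_mx_norm x)); rewrite exprMn ler_pM ?sqr_ge0//.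
  by have := sqr_ge0 (d%:R : R); lra.
by rewrite ler_sqr ?nnegrE// Hr.
Qed.

Lemma compact_sqn_bounded (F : 'rV[R]_d -> 'rV[R]_d) (K : set 'rV[R]_d) :
  compact K -> continuous F ->
  exists2 q : R, 0 <= q & forall x, K x -> sqn (F x) <= q.
Proof.
move=> cK cF.
have [r r0 Hr] := compact_enorm_bounded
  (continuous_compact (continuous_subspaceT cF) cK).
exists (r ^+ 2) => [|x Kx]; first exact: sqr_ge0.
by rewrite -enorm_le ?(ltW r0)// Hr//; exists x.
Qed.

Lemma compact_fun_bounded (f : 'rV[R]_d -> R) (K : set 'rV[R]_d) :
  compact K -> continuous f ->
  exists2 q : R, 0 <= q & forall x, K x -> f x <= q.
Proof.
move=> cK cf.
have [r [_ Hr]] := compact_bounded (continuous_compact (continuous_subspaceT cf) cK).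
have rq : r < `|r| + 1 by apply: le_lt_trans (ler_norm r) _; rewrite ltrDl.
exists (`|r| + 1) => [|x Kx]; first by rewrite addr_ge0.
by apply: (le_trans (ler_norm _)); apply: (Hr _ rq); exists x.
Qed.

Lemma dist_to_ge0 (x : 'rV[R]_d) (C : set 'rV[R]_d) : C !=set0 -> 0 <= dist_to x C.
Proof.
move=> [c Cc]; apply: lb_le_inf; first by exists (enorm (x - c)), c.
by move=> _ [y _ <-]; exact: enorm_ge0.
Qed.

Lemma dist_to_le (x c : 'rV[R]_d) (C : set 'rV[R]_d) : C c ->
  dist_to x C <= enorm (x - c).
Proof.
move=> Cc; apply: ge_inf; last by exists c.
by exists 0 => _ [y _ <-]; exact: enorm_ge0.
Qed.

Lemma enorm_le_mx_norm (x : 'rV[R]_d) : enorm x <= (d%:R + 1) * `|x|.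
Proof.
have d0 : (0 : R) <= d%:R by [].
rewrite enorm_le ?mulr_ge0 ?addr_ge0//.
apply: (le_trans (sqn_le_mx_norm x)); rewrite exprMn ler_wpM2r ?sqr_ge0//.
by have := sqr_ge0 (d%:R : R); lra.
Qed.

Lemma infinite_nat_unbounded (S : set nat) : infinite_set S ->
  forall n, exists2 k, (n <= k)%N & S k.
Proof.
move=> iS n; apply: contrapT => H; apply: iS.
apply: (sub_finite_set (B := `I_n)); last exact: finite_II.
move=> k Sk /=; rewrite ltnNge; apply/negP => nk.
by apply: H; exists k.
Qed.


Lemma open_neighbourhood (A : set 'rV[R]_d) (r : R) :
  open [set x | exists2 c, A c & `|x - c| < r].
Proof.
rewrite (_ : [set x | _] = \bigcup_(c in A) ball c r).
  by apply: bigcup_open => c _; exact: ball_open.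
apply/seteqP; split => [x [c Ac xc]|x [c Ac]].
  by exists c => //; rewrite -ball_normE/= distrC.
by rewrite -ball_normE/= distrC => xc; exists c.
Qed.

End assembly.


(* The size of the training data is N = n.+1; gamma k is the step-size
   gamma_{k+1} (see adam_algorithm). *)
Theorem theorem2p4 (R : realType)
    (eps beta alpha p : R) (d : nat) (vartheta : 'rV[R]_d)
    (gamma : nat -> R)
    (Y : Type) (n : nat) (y : 'I_n.+1 -> Y) (z : 'I_n.+1 -> R)
    (NN : 'rV[R]_d -> Y -> R) (M : nat)
    (dO' dO : measure_display)
    (Omega' : measurableType dO') (P' : probability Omega' R)
    (U : {RV P' >-> (M.-tuple 'I_n.+1)%type})
    (Omega : measurableType dO) (P : probability Omega R)
    (theta : nat -> Omega -> 'rV[R]_d)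
    (C K D : set 'rV[R]_d) :
  let loss := empirical_loss NN y z in
  let X := @minibatch_gradient R d Y n.+1 M NN y z in
  0 < eps ->
  4^-1 < beta < 1 ->
  0 <= alpha < Num.sqrt beta ->
  2 <= p ->
  (0 < d)%N ->
  (forall k, 0 < gamma k) ->
  ~ cvgn (series gamma) ->
  nonincreasing_seq gamma ->
  gamma @ \oo --> 0 ->
  (0 < ereal_sup
         [set limn_einf (fun k =>
            ((gamma k)^-1
             * gamma (k + `|Num.ceil ((gamma k)^-1 * e)|)%N)%:E)
         | e in [set e : R | (0 < e)%R] ])%E ->
  cvgn (series (fun k => gamma k `^ (1 + p / 3))) ->
  (forall y0, C1 (NN^~ y0)) ->
  injective y ->
  (0 < M)%N ->
  independent_uniform U ->
  innovation_fun X ->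
  locally_regular p X U ->
  batch_threshold beta n.+1 < M%:R ->
  adam_algorithm P X U gamma alpha beta eps vartheta theta ->
  closed C ->
  C !=set0 ->
  C `<=` loss @^-1` [set 0] ->
  compact K ->
  set_nbhs (C `&` K) D ->
  C `&` D = argmin_on loss D ->
  PL_on loss D ->
  exists2 V : set 'rV[R]_d, set_nbhs (C `&` K) V &
    {ae P, forall w,
      ([set w | infinite_set [set k | V (theta k w)]] `&`
       \bigcup_k0 \bigcap_(k in [set k | (k0 <= k)%N]) (theta k @^-1` K)) w ->
      (fun k => dist_to (theta k w) C) @ \oo --> 0}.
Proof.
move=> loss X eps0 /andP[beta4 beta1] /andP[alpha0 alphab] p2 d0 gamma0 gnc gdec
  g0 _ _ NNC1 _ M0 unif _ reg _ adam clC C0 CR cK nD CD [mu mu0 PL].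
have beta0 : 0 <= beta by apply: ltW; apply: lt_trans beta4; rewrite invr_gt0.
have alpha1 : alpha < 1.
  by apply: (lt_le_trans alphab); rewrite -sqrtr1 ler_wsqrtr// ltW.
have alpha01 : 0 <= alpha < 1 by rewrite alpha0.
have beta01 : 0 <= beta < 1 by rewrite beta0.
have loss0 x : 0 <= loss x by exact: loss_ge0.
have dloss x : differentiable loss x by exact: loss_differentiable.
have closs : continuous loss by move=> x; exact: differentiable_continuous.
have DC x : D x -> loss x = 0 -> C x.
  move=> Dx lx; suff : (C `&` D) x by case.
  by rewrite CD; split => // x' _; rewrite lx.
have cCK : compact (C `&` K) by rewrite setIC; exact: compact_closedI.
have [r r_gt0 [rD rO]] := zero_set_isolated closs loss0 cCK cK nD DC.
pose O := [set x | exists2 c, (C `&` K) c & `|x - c| < r / 2].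
pose N := [set x | exists2 c, (C `&` K) c & `|x - c| <= r].
have r2 : 0 < r / 2 by lra.
have oO : open O by exact: open_neighbourhood.
have AO : C `&` K `<=` O.
  by move=> x Ax; exists x => //; rewrite subrr normr0.
have ON x x' : O x -> `|x' - x| <= r / 2 -> N x'.
  move=> [c Ac xc] x'x; exists c => //; rewrite -(subrKA x).
  by apply: (le_trans (ler_normD _ _)); lra.
have OPL x : O x -> 2 * mu * loss x <= sqn (grad loss x).
  move=> [c Ac xc]; rewrite -enorm_sqr; apply: PL; apply: (rD c) => //; lra.
have [r1 r1_gt0 NO] := rO O oO AO.
have T0 : (0 < #|{: M.-tuple 'I_n.+1}|)%N by rewrite card_tuple card_ord expn_gt0.
have T0R : (0 : R) < #|{: M.-tuple 'I_n.+1}|%:R by rewrite ltr0n.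
have /choice[q Hq] (k : 'I_n.+1) : exists q : R, 0 <= q /\
    forall x, K x -> sqn (model_grad NN y k x) <= q.
  by have [q q0 Hq] := compact_sqn_bounded cK (NNC1 (y k)).2; exists q.
pose B0 := 1 + \sum_k q k.
have Bk x k : K x -> sqn (model_grad NN y k x) <= B0.
  move=> Kx; apply: (le_trans ((Hq k).2 x Kx)); rewrite /B0 (bigD1 k)//= addrCA lerDl.
  by rewrite addr_ge0//; apply: sumr_ge0 => i _; exact: (Hq i).1.
have B0_gt0 : 0 < B0.
  by rewrite ltr_pwDl//; apply: sumr_ge0 => i _; exact: (Hq i).1.
pose B := 2 * n.+1%:R * B0.
have B_gt0 : 0 < B by rewrite !mulr_gt0.
have XB x u : K x -> sqn (X u x) <= B * loss x.
  by move=> Kx; apply: minibatch_sqn_le => // k; exact: Bk.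
have [F F0 HF] := compact_fun_bounded cK closs.
have BX0 : 0 <= B * F by rewrite mulr_ge0// ltW.
have XBX x u : K x -> sqn (X u x) <= B * F.
  by move=> Kx; apply: (le_trans (XB x u Kx)); rewrite ler_wpM2l ?(ltW B_gt0)// HF.
have Xmean x : \sum_u X u x = - (#|{: M.-tuple 'I_n.+1}|%:R *: grad loss x).
  exact: sum_minibatch.
have [rho rho0 Hrho] := compact_enorm_bounded cK.
have p0 : 0 < p by apply: lt_le_trans p2.
have [L L0 HL] := regular_batch_lipschitz rho p0 unif reg.
have lip x x' : enorm x <= rho -> enorm x' <= rho ->
    sqn (grad loss x' - grad loss x) <= L ^+ 2 * sqn (x' - x).
  move=> xr x'r.
  have := sqn_sum (fun u => X u x' - X u x).
  rewrite sumrB !Xmean -opprD -scalerBr sqnN sqnZ expr2 -mulrA ler_pM2l// => h.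
  rewrite -(ler_pM2l T0R); apply: (le_trans h).
  rewrite mulr_natl -sumr_const; apply: ler_sum => u _.
  rewrite -!enorm_sqr -exprMn ler_sqr ?nnegrE ?mulr_ge0 ?enorm_ge0 ?(ltW L0)//.
  exact: HL.
have smooth x x' : K x -> K x' ->
    loss x' <= loss x + dot (grad loss x) (x' - x) + L * sqn (x' - x).
  move=> Kx Kx'; rewrite -{1}(subrKC x x'); apply: descent => // t t01.
  have := lip x (x + t *: (x' - x)) (Hrho x Kx).
  rewrite addrAC subrr add0r sqnZ => h; apply: (le_trans (h _)).
    rewrite enorm_le ?(ltW rho0)//.
    have -> : x + t *: (x' - x) = t *: x' + (1 - t) *: x.
      by rewrite scalerBr scalerBl scale1r addrCA.
    apply: (le_trans (sqn_convex _ _ t01)); case/andP: t01 => t0 t1.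
    have h1 : sqn x <= rho ^+ 2 by rewrite -enorm_le ?(ltW rho0)// Hrho.
    have h2 : sqn x' <= rho ^+ 2 by rewrite -enorm_le ?(ltW rho0)// Hrho.
    have t1' : 0 <= 1 - t by rewrite subr_ge0.
    by have := ler_wpM2l t0 h2; have := ler_wpM2l t1' h1; lra.
  rewrite ler_wpM2l ?sqr_ge0// ler_piMl ?sqn_ge0//.
  by case/andP: t01 => t0 t1; rewrite exprn_ile1.
have [s s_spec] := discounted_sum alpha01 gamma0 gdec.
have gdiv := nonneg_series_unbounded (fun k => ltW (gamma0 k)) gnc.
have uc e : 0 < e -> exists2 h : R, 0 < h &
    forall x x', K x -> `|x - x'| <= h -> loss x' <= loss x + e.
  exact: compact_uniformly_continuous.
have [Us [m [v [iid init step]]]] := adam.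
have lipK x x' : K x -> K x' ->
    sqn (grad loss x' - grad loss x) <= L ^+ 2 * sqn (x' - x).
  by move=> Kx Kx'; apply: lip; exact: Hrho.
have key := adam_converges_in_trap T0 gamma0 gdec alpha01 beta01 eps0 s_spec loss0
  B_gt0 XB BX0 XBX Xmean L0 smooth lipK mu0 OPL r2 ON r1_gt0 NO
  (batch_cylinder_measurable (P := P) Us) (batch_cylinder_prob unif iid)
  g0 gdiv uc (vartheta, 0, 0).
set l := entry_level _ _ _ _ _ _ in key.
have l_gt0 : 0 < l by exact: entry_level_gt0.
exists (O `&` [set x | loss x < l]).
  move=> x Ax; apply: filterI; first by apply: open_nbhs_nbhs; split => //; exact: AO.
  have /cvgrPdist_lt/(_ _ l_gt0) := closs x.
  apply: filterS => x'; have -> : loss x = 0 by apply: CR; case: Ax.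
  by rewrite sub0r normrN => /(le_lt_trans (ler_norm _)).
(* The given iterates are the states of the tree along the drawn batches. *)
have stE w k : adam_state X gamma alpha beta eps (vartheta, 0, 0)
    (history (fun k w => Us k w) k w) = (theta k w, m k w, v k w).
  elim: k => [|k IH]; first by have [-> -> ->] := init w.
  rewrite /= IH size_history; have [mE vE] := step k w.
  have v'E : (\row_j (beta * v k w 0 j + (1 - beta) * X (Us k w) (theta k w) 0 j ^+ 2))
      = v k.+1 w.
    by apply/rowP => j; rewrite mxE; have [-> _] := vE j.
  rewrite /adam_next/= v'E -mE; congr (_, _, _).
  by apply/rowP => j; rewrite mxE; have [_ ->] := vE j.
apply: filterS key => w key [io [n0 _ Kev]].
have {}key : forall e : R, 0 < e -> exists n1, forall k, (n1 <= k)%N ->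
    K (theta k w) /\ O (theta k w) /\ loss (theta k w) < e.
  move=> e e0; have [||n1 Hn1] := key _ _ e e0.
  - by exists n0 => k nk; rewrite stE; exact: Kev.
  - move=> N1; have [k Nk [Ok lk]] := infinite_nat_unbounded io N1.
    by exists k => //; rewrite stE.
  - by exists n1 => k /Hn1; rewrite stE.
apply/cvgrPdist_lt => e e0.
have e'0 : 0 < e / (d%:R + 1) by rewrite divr_gt0// ltr_wpDl.
have [||l' l'0 Hl'] := rO [set x | exists2 c, (C `&` K) c & `|x - c| < e / (d%:R + 1)].
- exact: open_neighbourhood.
- by move=> x Ax; exists x => //; rewrite subrr normr0.
have [n1 Hn1] := key l' l'0.
exists n1 => // k /= /Hn1[Kk [Ok lk]].
rewrite sub0r normrN ger0_norm ?dist_to_ge0//.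
have [|c [Cc _] kc] := Hl' _ Kk _ lk.
  by have [c Ac kc] := Ok; exists c => //; lra.
apply: (le_lt_trans (dist_to_le _ Cc)); apply: (le_lt_trans (enorm_le_mx_norm _)).
by rewrite mulrC -ltr_pdivlMr// ltr_wpDl.
Qed.
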